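(* There is a universal numerical constant $C$ such that the following holds. Let $T$ be a finite nonempty set, $X$ a real separable $(2,D)$-smooth Banach space with $D\ge1$, and $\mu$ a deterministic probability measure on $T$ charging every point. Let $(\mathcal F_j)_{j=0}^N$ be a filtration, and for $i=1,\dots,N$ let $\varepsilon_i$ be a symmetric random sign ($\mathbb P\{\varepsilon_i=1\}=\mathbb P\{\varepsilon_i=-1\}=1/2$) that is independent of $\mathcal F_{i-1}$ and $\mathcal F_i$-measurable, and let $a_i(t)\in X$ be $\mathcal F_{i-1}$-measurable for each $t\in T$. Put $f_0(t)=0$, $f_j(t)=\sum_{i=1}^ja_i(t)\varepsilon_i$, and $d(t,u)=\big(\sum_{i=1}^N\|a_i(t)-a_i(u)\|^2\big)^{1/2}$. Then for every $p\ge1$, $$\Big\|\max_{0\le j\le N}\operatorname{osc}_Tf_j\Big\|_{L^p}\le CD\,\big\|\Gamma_\mu(d)+\sqrt p\,\Delta_d\big\|_{L^p},$$ where $\operatorname{osc}_T f_j=\max_{t,u\in T}\|f_j(t)-f_j(u)\|$. The inequality is understood in the extended sense when the right-hand side is infinite.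
   Context: Smoothness: a Banach space $X$ is $(2,D)$-smooth if $\|x+y\|^2+\|x-y\|^2\le 2\|x\|^2+2D^2\|y\|^2$ for all $x,y\in X$. For a pseudometric $d$ on $T$: $\Delta_d=\max_{t,u\in T}d(t,u)$, $B_d(t,r)=\{u\in T:d(t,u)\le r\}$, and $\Gamma_\mu(d)=\sup_{t\in T}\int_0^{\Delta_d}\sqrt{\log\frac{e}{\mu(B_d(t,r))}}\,dr$ (equal to $0$ if $\Delta_d=0$). *)

(* Defs.v *)
From HB Require Import structures.
From mathcomp Require Import all_boot all_order all_algebra.
From mathcomp Require Import all_classical all_reals all_analysis.

Set Implicit Arguments.
Unset Strict Implicit.
Unset Printing Implicit Defensive.

Import Order.TTheory GRing.Theory Num.Theory.
Import numFieldNormedType.Exports.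

Local Open Scope classical_set_scope.
Local Open Scope ring_scope.

Definition smooth2 (R : realType) (X : normedModType R) (D : R) : Prop :=
  forall x y : X,
    `|x + y| ^+ 2 + `|x - y| ^+ 2 <= 2 * `|x| ^+ 2 + 2 * D ^+ 2 * `|y| ^+ 2.

Definition separable (X : topologicalType) : Prop :=
  exists2 S : set X, countable S & dense S.

(* Probability measures on the sigma-algebra of all subsets of a finite set,
   where finite additivity is countable additivity.  The measurable types of the
   library carry a distinguished point, which a finType lacks. *)
Definition finite_probability (R : realType) (T : finType)
    (mu : {set T} -> R) : Prop :=
  [/\ forall A, 0 <= mu A,
      mu [set: T]%SET = 1 &
      forall A B : {set T},
        (A :&: B = finset.set0)%SET -> mu (A :|: B)%SET = mu A + mu B].

Section Pseudometric.
Variables (R : realType) (T : finType).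
Implicit Type d : T -> T -> R.

(* The default value 0 of the maximum is harmless, as d takes nonnegative
   values. *)
Definition diam d : R :=
  \big[Num.max/0]_(t : T) \big[Num.max/0]_(u : T) d t u.

Definition pball d (t : T) (r : R) : {set T} := [set u | d t u <= r]%SET.

(* When diam d = 0 the integrals are over the null set {0}, so that
   Gamma mu d = 0 as soon as T is nonempty. *)
Definition Gamma (mu : {set T} -> R) d : \bar R :=
  ereal_sup (range (fun t : T =>
    (\int[@lebesgue_measure R]_(r in `[0%R, diam d]%classic)
      (Num.sqrt (ln (expR 1 / mu (pball d t r))))%:E)%E)).

End Pseudometric.

Definition osc (R : realType) (X : normedModType R) (T : finType)
    (f : T -> X) : R :=
  \big[Num.max/0]_(t : T) \big[Num.max/0]_(u : T) `|f t - f u|.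

Section Probability.
Variables (R : realType) (dO : measure_display) (Omega : measurableType dO).
Implicit Types (P : probability Omega R) (F : nat -> set (set Omega)).
Implicit Types (G : set (set Omega)) (e : Omega -> R).

Definition filtration (N : nat) F : Prop :=
  (forall j, (j <= N)%N -> sigma_algebra [set: Omega] (F j)) /\
  (forall j, (j <= N)%N -> F j `<=` measurable) /\
  (forall i j, (i <= j <= N)%N -> F i `<=` F j).

Definition borel_measurable_wrt (X : topologicalType) G (f : Omega -> X) :
    Prop :=
  forall B : set X, <<s @open X >> B -> G (f @^-1` B).

Definition symmetric_sign P e : Prop :=
  P (e @^-1` [set 1]) = (2^-1)%:E /\ P (e @^-1` [set (-1)]) = (2^-1)%:E.

Definition independent_of P G e : Prop :=
  forall (A : set Omega) (B : set R), G A -> measurable B ->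
    P (A `&` e @^-1` B) = (P A * P (e @^-1` B))%E.

End Probability.

Section SignedSums.
Variables (R : realType) (Omega : Type) (X : normedModType R) (T : finType).
Variables (a : nat -> T -> Omega -> X).

Definition sign_sum (eps : nat -> Omega -> R) (j : nat) (w : Omega) (t : T) :
    X :=
  \sum_(1 <= i < j.+1) eps i w *: a i t w.

Definition coef_dist (N : nat) (w : Omega) (t u : T) : R :=
  Num.sqrt (\sum_(1 <= i < N.+1) `|a i t w - a i u w| ^+ 2).

End SignedSums.

(* Main.v *)
Require Import Defs.
From HB Require Import structures.
From mathcomp Require Import all_boot all_order all_algebra.
From mathcomp Require Import all_classical all_reals all_analysis.
From mathcomp Require Import ring lra measurable_realfun.

Set Implicit Arguments.
Unset Strict Implicit.
Unset Printing Implicit Defensive.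

Import Order.TTheory GRing.Theory Num.Theory.
Import numFieldNormedType.Exports.

Local Open Scope classical_set_scope.
Local Open Scope ring_scope.

(* Fix lam > 0.  Multiply a_i by the predictable indicator of the times between
   the first one at which the oscillation exceeds lam and the first one at which
   it exceeds 4 lam, and stop as soon as Gamma(d_i) + sqrt p diam(d_i) exceeds
   del lam.  The resulting process has a metric d' bounded in terms of the
   deterministic numbers del lam and del lam / sqrt p =: Dl.  For every l,
   (2,D)-smoothness makes
     cosh (l |f'(u) - f'(v)|) exp (- l^2 D^2 d'(u,v)^2 / 2)
   a supermartingale; it is averaged over mu x mu and used simultaneously for
   all l = (n + 1) 2^k / (D Dl).  The weights 2^-(k+n) in the union bound are
   harmless because the radii Dl 2^-k start at the deterministic number Dl,
   whatever the random metric.  Averaging over the d'-balls of radii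
   Dl 2^-k and chaining bounds the oscillation of f' by 136 D del lam.  Hence
     P(Y > 4 lam, W <= del lam) <= e^(-4p) P(Y > lam),
   where Y is the maximal oscillation and W = Gamma(d) + sqrt p diam(d), and
   this good-lambda inequality is integrated against p lam^(p-1) d lam. *)

(** * Smoothness and the hyperbolic cosine *)

(** The obstacle is that the parameter of an exponential supermartingale must be fixed in advance,
    whereas the best parameter for a link of the chain depends on the masses of balls of a random
    metric. Averaging over mu x mu before any ball is chosen takes the balls out of the
    probabilistic part: one countable family of parameters serves all metrics, and on the event
    where all the averages are small the chaining is deterministic. The factor P(Y > lam) needs no
    conditioning at a stopping time: where Y <= lam the localised process vanishes and its
    exponential stays equal to 1. The gap from lam to 4 lam leaves room for overshoot. A jump is at
    most diam d, hence at most lam, so f oscillates by at most 2 lam at the starting time and f' by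
    more than 2 lam at the end; with del = 1 / (136 D) chaining allows f' only lam. The rate 4 p is
    chosen to beat the factor 4^p lost in comparing the levels lam and 4 lam. *)

Section Cosh.
Variable R : realType.
Implicit Types x y a h m : R.

Definition cosh x : R := (expR x + expR (- x)) / 2.

Lemma cosh_gt0 x : 0 < cosh x.
Proof. by rewrite divr_gt0 // addr_gt0 // expR_gt0. Qed.

Lemma cosh0 : cosh 0 = 1.
Proof. by rewrite /cosh oppr0 expR0; lra. Qed.

Lemma coshN x : cosh (- x) = cosh x.
Proof. by rewrite /cosh opprK addrC. Qed.

Lemma cosh_norm x : cosh `|x| = cosh x.
Proof. by case: (ger0P x) => _ //; rewrite coshN. Qed.

Lemma expR_le_cosh x : expR x <= 2 * cosh x.
Proof. by rewrite /cosh; have := expR_gt0 (- x); lra. Qed.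

Lemma coshDB x y : cosh (x + y) + cosh (x - y) = 2 * (cosh x * cosh y).
Proof. by rewrite /cosh !opprD !opprK !expRD; field. Qed.

Lemma continuous_expRN : continuous (fun x : R => expR (- x)).
Proof.
move=> x; apply: continuous_comp; first exact: opp_continuous.
exact: continuous_expR.
Qed.

Lemma continuous_cosh : continuous cosh.
Proof.
move=> x; apply: cvgM; last exact: cvg_cst.
by apply: cvgD; [exact: continuous_expR | exact: continuous_expRN].
Qed.

(** This is tanh x <= x. The right side minus the left is [q], which vanishes at 0 and has a
    nonnegative derivative. *)
Lemma sinh_le_cosh x : 0 <= x ->
  expR x - expR (- x) <= x * (expR x + expR (- x)).
Proof.
move=> x0; pose q (x : R) : R := (1 + x) * expR (- x) - (1 - x) * expR x.
have dq y : is_derive y 1 q (y * (expR y - expR (- y))).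
  by apply: is_derive_eq; rewrite /GRing.scale /=; ring.
suff : q 0 <= q x by rewrite /q oppr0 expR0; lra.
apply: (@ger0_derive1_le_cc _ q 0 x) => //.
- by move=> y; rewrite in_itv /= => /andP[y0 _]; rewrite derive1E derive_val
    mulr_ge0 ?(ltW y0)// subr_ge0 ler_expR; lra.
- by apply: continuous_subspaceT => y; apply: differentiable_continuous;
    exact/derivable1_diffP.
- by rewrite in_itv /= lexx.
- by rewrite in_itv /= lexx andbT.
Qed.

(** Since tanh x <= x, the function cosh x exp(- x^2 / 2) is nonincreasing for x >= 0. *)
Lemma cosh_growth a m : 0 <= a -> a <= m ->
  cosh m <= cosh a * expR ((m ^+ 2 - a ^+ 2) / 2).
Proof.
move=> a0 am; pose q (x : R) : R := cosh x * expR (- (x ^+ 2 / 2)).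
have dq y : is_derive y 1 q
    ((expR y - expR (- y) - y * (expR y + expR (- y))) / 2
     * expR (- (y ^+ 2 / 2))).
  rewrite /q /cosh; apply: is_derive_eq; rewrite /GRing.scale /=.
  rewrite !(mulr0, mulr1, add0r, addr0) /=.
  move: (expR (- (y ^+ 2 / 2))) (expR y) (expR (- y)) => E e1 e2.
  by field.
have : q m <= q a.
  apply: (@ler0_derive1_le_cc _ q 0 m) => //.
  - move=> y; rewrite in_itv /= => /andP[y0 _]; rewrite derive1E derive_val.
    rewrite mulr_le0_ge0 ?expR_ge0//.
    by have := sinh_le_cosh (ltW y0); lra.
  - by apply: continuous_subspaceT => y; apply: differentiable_continuous;
      exact/derivable1_diffP.
  - by rewrite in_itv /= (le_trans a0 am) lexx.
  - by rewrite in_itv /= a0.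
move=> qma; have -> : cosh m = q m * expR (m ^+ 2 / 2).
  by rewrite /q -mulrA -expRD addNr expR0 mulr1.
rewrite (le_trans (ler_wpM2r (expR_ge0 _) qma))// /q -mulrA -expRD.
by rewrite ler_wpM2l ?(ltW (cosh_gt0 _))// ler_expR; lra.
Qed.

Lemma cosh_le a m : 0 <= m -> m <= a -> cosh m <= cosh a.
Proof.
move=> m0 ma; pose q := cosh; have dq y : is_derive y 1 q
   ((expR y - expR (- y)) / 2).
  by rewrite /q /cosh; apply: is_derive_eq; rewrite /GRing.scale /=; field.
apply: (@ger0_derive1_le_cc _ q 0 a) => //.
- move=> y; rewrite in_itv /= => /andP[y0 _]; rewrite derive1E derive_val.
  by rewrite divr_ge0// subr_ge0 ler_expR; lra.
- by apply: continuous_subspaceT => y; exact: continuous_cosh.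
- by rewrite in_itv /= m0.
- by rewrite in_itv /= (le_trans m0 ma) lexx.
Qed.

Lemma cosh_le_gauss h : cosh h <= expR (h ^+ 2 / 2).
Proof.
rewrite -cosh_norm -real_normK ?num_real//.
have := @cosh_growth 0 `|h| (lexx _) (normr_ge0 _).
by rewrite cosh0 mul1r expr0n subr0.
Qed.

(* With |x + y| = m + h and |x - y| = m - h, smoothness says
   m^2 + h^2 <= |x|^2 + D^2 |y|^2, while |h| <= |y| by the triangle inequality;
   and log (cosh (sqrt z)) grows at rate at most 1/2. *)
Lemma smooth2_cosh (X : normedModType R) (D l : R) (x y : X) :
  1 <= D -> smooth2 X D ->
  cosh (l * `|x + y|) + cosh (l * `|x - y|) <=
  2 * (cosh (l * `|x|) * expR (l ^+ 2 * D ^+ 2 * `|y| ^+ 2 / 2)).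
Proof.
move=> D1 /(_ x y); pose m := (`|x + y| + `|x - y|) / 2.
pose h := (`|x + y| - `|x - y|) / 2.
have -> : `|x + y| = m + h by rewrite /m /h; field.
have -> : `|x - y| = m - h by rewrite /m /h; field.
have m0 : 0 <= m by rewrite divr_ge0// addr_ge0.
have hy : h ^+ 2 <= `|y| ^+ 2.
  rewrite -[h ^+ 2]real_normK ?num_real// lerXn2r ?nnegrE ?normr_ge0//.
  have H1 : `|x + y| <= `|x - y| + `|y| *+ 2.
    have -> : x + y = (x - y) + y *+ 2 by rewrite mulr2n addrA subrK.
    by rewrite (le_trans (ler_normD _ _))// lerD2l// -normrMn.
  have H2 : `|x - y| <= `|x + y| + `|y| *+ 2.
    have -> : x - y = (x + y) - y *+ 2 by rewrite mulr2n opprD addrA addrK.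
    by rewrite (le_trans (ler_normB _ _))// lerD2l// -normrMn.
  by rewrite /h ler_norml; apply/andP; split; lra.
clearbody m h; set a := `|x|; set b := `|y| => Hsm.
have hb : h ^+ 2 <= D ^+ 2 * b ^+ 2.
  by rewrite (le_trans hy)// ler_peMl ?sqr_ge0// expr_ge1// (le_trans _ D1).
have {Hsm} mh : m ^+ 2 + h ^+ 2 <= a ^+ 2 + D ^+ 2 * b ^+ 2 by lra.
have -> : l * (m + h) = l * m + l * h by ring.
have -> : l * (m - h) = l * m - l * h by ring.
rewrite coshDB ler_pM2l// -cosh_norm normrM (ger0_norm m0).
rewrite -(cosh_norm (l * a)) normrM (ger0_norm (normr_ge0 x)) -/a.
set L := `|l|; have L0 : 0 <= L by exact: normr_ge0.
have a0 : 0 <= a by exact: normr_ge0.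
have lL : l ^+ 2 = L ^+ 2 by rewrite real_normK ?num_real.
have L2 : 0 <= L ^+ 2 by exact: sqr_ge0.
have ch := cosh_le_gauss (l * h).
(* If m exceeds |x|, the growth of cosh from |x| to m and the factor cosh (l h) together cost m^2 +
   h^2 - |x|^2. Otherwise cosh (l m) is at most cosh (l |x|), and [hb], which comes from D >= 1,
   pays for the other factor. *)
have [am|/ltW ma] := leP a m.
- have := @cosh_growth (L * a) (L * m) (mulr_ge0 L0 a0) (ler_wpM2l L0 am).
  move=> cg; apply: (le_trans (ler_pM _ _ cg ch)); rewrite ?(ltW (cosh_gt0 _))//.
  rewrite -[leLHS]mulrA -expRD ler_wpM2l ?(ltW (cosh_gt0 _))// ler_expR.
  have := ler_wpM2l L2 mh; rewrite !exprMn lL; lra.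
- apply: ler_pM; rewrite ?(ltW (cosh_gt0 _))//.
  + by apply: cosh_le; [rewrite mulr_ge0|rewrite ler_wpM2l].
  + apply: (le_trans ch); rewrite ler_expR exprMn lL.
    have := ler_wpM2l L2 hb; lra.
Qed.

End Cosh.

(** * Measurability in separable spaces *)

Section OpenMeasurable.
Context d (S : measurableType d) (R : realType).

Definition borel_fun (X : topologicalType) (f : S -> X) :=
  forall U, open U -> measurable (f @^-1` U).

Lemma countable_bigcup_measurable (I : Type) (A : set I) (F : I -> set S) :
  countable A -> (forall i, A i -> measurable (F i)) ->
  measurable (\bigcup_(i in A) F i).
Proof.
move=> /countable_injP[f injf] mF.
have -> : \bigcup_(i in A) F i =
    \bigcup_n \bigcup_(i in [set i | A i /\ f i = n]) F i.
  apply/seteqP; split=> [s [i Ai Fis]|s [n _ [i [Ai _] Fis]]]; last by exists i.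
  by exists (f i) => //; exists i.
apply: bigcupT_measurable => n.
have [[i [Ai fin]]|/forallNP no] := pselect (exists i, A i /\ f i = n).
  rewrite (_ : \bigcup_(_ in _) _ = F i); first exact: mF.
  apply/seteqP; split=> [s [j [Aj fj]]|s Fis]; last by exists i.
  by have -> : j = i by apply: injf; rewrite ?inE ?fj ?fin.
rewrite (_ : \bigcup_(_ in _) _ = set0) //.
by apply/seteqP; split=> // s [j hj _]; case: (no j).
Qed.

Lemma borel_fun_comp (X Y : topologicalType) (phi : X -> Y) (f : S -> X) :
  continuous phi -> borel_fun f -> borel_fun (phi \o f).
Proof. by move=> /continuousP cphi mf U oU; exact: (mf _ (cphi _ oU)). Qed.

(** Separability acts here: an open set of the product is a countable union of rectangles of balls
    centred in the dense sets, so its preimage is a countable union of intersections. Interiors are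
    taken because a [ball] need not be open. *)
Lemma borel_fun_comp2 (X Y : pseudoPMetricType R) (Z : topologicalType)
    (phi : X * Y -> Z) (f : S -> X) (g : S -> Y) :
  separable X -> separable Y -> continuous phi ->
  borel_fun f -> borel_fun g ->
  borel_fun (fun s => phi (f s, g s)).
Proof.
move=> [D1 cD1 dD1] [D2 cD2 dD2] cphi mf mg U oU.
pose r n : R := n.+1%:R^-1.
have r0 n : 0 < r n by rewrite invr_gt0.
pose I := [set i : X * Y * nat | (D1 i.1.1 /\ D2 i.1.2) /\
  forall x y, ball i.1.1 (r i.2) x -> ball i.1.2 (r i.2) y -> U (phi (x, y))].
have -> : (fun s => phi (f s, g s)) @^-1` U = \bigcup_(i in I)
    (f @^-1` (ball i.1.1 (r i.2))° `&` g @^-1` (ball i.1.2 (r i.2))°).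
  apply/seteqP; split=> [s /= Us|s [[[x y] n]] /= [_ H] []]; last first.
    move=> /interior_subset ? /interior_subset ?.
    exact: H.
  have /nbhs_ballP[e /= e0 He] : nbhs (f s, g s) (phi @^-1` U).
    by apply: cphi; rewrite nbhsE; exists U.
  (* With centres within [r n / 2] of the given point and [r n < e / 2], a ball of radius [r n]
     about a centre remains inside the ball of radius e about the point. *)
  have [n ne] : exists n, r n < e / 2.
    have e20 : 0 < e / 2 by rewrite divr_gt0.
    have [n _ /(_ n (leqnn _)) ne] := near_infty_natSinv_lt (PosNum e20).
    by exists n.
  have rn2 : 0 < r n / 2 by rewrite divr_gt0.
  have [x [xb Dx]] : (ball (f s) (r n / 2))° `&` D1 !=set0.
    by apply: dD1; [exists (f s); exact: nbhsx_ballx | exact: open_interior].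
  have [y [yb Dy]] : (ball (g s) (r n / 2))° `&` D2 !=set0.
    by apply: dD2; [exists (g s); exact: nbhsx_ballx | exact: open_interior].
  have xs : ball x (r n / 2) (f s) by apply: ball_sym; exact: interior_subset xb.
  have ys : ball y (r n / 2) (g s) by apply: ball_sym; exact: interior_subset yb.
  exists (x, y, n).
    rewrite /I /mkset /=; split=> [|x' y' bx' by'] //.
    apply: He; split => /=.
      by apply: (@le_ball _ _ _ (r n / 2 + r n)); [lra|];
        apply: ball_triangle bx'; apply: ball_sym.
    by apply: (@le_ball _ _ _ (r n / 2 + r n)); [lra|];
      apply: ball_triangle by'; apply: ball_sym.
  split => /=; apply/nbhs_ballP; exists (r n / 2) => //= z bz;
    by rewrite (splitr (r n)); apply: ball_triangle bz.
apply: countable_bigcup_measurable.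
  apply: (@sub_countable _ _ _ ((D1 `*` D2) `*` [set: nat])).
    by apply: subset_card_le => -[[x y] n] /= [].
  by apply: countableX; [exact: countableX|exact: countableP].
move=> i _; apply: measurableI.
  by apply: mf; exact: open_interior.
by apply: mg; exact: open_interior.
Qed.

Lemma borel_funP (f : S -> R) :
  borel_fun f <-> measurable_fun setT f.
Proof.
split=> [mf|mf U oU].
  apply: (measurability _ (RGenOpens.measurableE R)).
  move=> _ [_ [a [b ->]] <-]; rewrite setTI; apply: mf; exact: interval_open.
by rewrite -[_ @^-1` _]setTI; apply: mf => //; exact: open_measurable.
Qed.

End OpenMeasurable.

Lemma separable_real (R : realType) : separable R.
Proof.
exists (@ratr R @` setT); last exact: dense_rat.
by apply: (@sub_countable _ _ _ [set: rat]); [exact: card_image_le|exact: countableP].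
Qed.

(** * Adapted maps and integration against an independent event *)

Section SubSigmaAlgebra.
Context d (Omega : measurableType d) (R : realType).
Implicit Types (F G : set (set Omega)) (Y : topologicalType).

Definition adapted_to F Y (f : Omega -> Y) :=
  borel_fun (f : g_sigma_algebraType F -> Y).

Lemma adapted_wrt F Y (f : Omega -> Y) :
  borel_measurable_wrt F f -> adapted_to F f.
Proof.
by move=> mf U oU; apply: sub_sigma_algebra; apply: mf; exact: sub_sigma_algebra.
Qed.

Lemma adapted_sub F G Y (f : Omega -> Y) : F `<=` G ->
  adapted_to F f -> adapted_to G f.
Proof.
by move=> FG mf U oU; apply: (sub_sigma_algebra2 FG); exact: mf.
Qed.

Lemma adapted_borel F Y (f : Omega -> Y) : F `<=` measurable ->
  adapted_to F f -> borel_fun f.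
Proof.
move=> Fm mf U oU; have := mf _ oU; apply: smallest_sub => //.
exact: sigma_algebra_measurable.
Qed.

Lemma adapted_cst F Y (y : Y) : adapted_to F (fun=> y).
Proof.
move=> U oU; have [Uy|nUy] := pselect (U y).
  rewrite (_ : _ @^-1` _ = setT); first exact: measurableT.
  by apply/seteqP; split.
rewrite (_ : _ @^-1` _ = set0); first exact: measurable0.
by apply/seteqP; split.
Qed.

(* g is integrated against the image of P under the identity of Omega onto
   (Omega, F), where the two measures agree. *)
Lemma integral_independent (P : {measure set Omega -> \bar R}) F
    (A : set Omega) (c : {nonneg R}) (g : Omega -> \bar R) :
  F `<=` measurable -> sigma_algebra setT F -> measurable A ->
  (forall E, F E -> P (E `&` A) = (c%:num%:E * P E)%E) ->
  measurable_fun setT (g : g_sigma_algebraType F -> \bar R) ->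
  (forall w, 0 <= g w)%E ->
  (\int[P]_(w in A) g w = c%:num%:E * \int[P]_w g w)%E.
Proof.
move=> Fm sF mA PA mg g0.
pose phi (w : Omega) : g_sigma_algebraType F := w.
have mphi : measurable_fun setT phi.
  move=> _ B; rewrite setTI; apply: smallest_sub => //.
  exact: sigma_algebra_measurable.
have mgO : measurable_fun setT g by exact: (measurableT_comp mg mphi).
have -> : (\int[P]_(w in A) g w = \int[mrestr P mA]_w g w)%E.
  rewrite -(setUv A) ge0_integral_setU //; last 3 first.
  - exact: measurableC.
  - by rewrite setUv.
  - by apply/disj_set2P; rewrite setICr.
  rewrite [X in (_ + X)%E](_ : _ = 0%E) ?adde0.
    by apply: eq_measure_integral => B mB BA; rewrite /= /mrestr setIidl.
  rewrite (@eq_measure_integral _ _ _ _ mzero) ?integral_measure_zero//.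
  move=> B mB BA; rewrite /= /mrestr (_ : _ `&` _ = set0) ?measure0//.
  by apply/seteqP; split => // w [/BA].
have push (m : {measure set Omega -> \bar R}) :=
  @ge0_integral_pushforward _ _ _ _ _ phi mphi m setT g measurableT mg
    (fun w _ => g0 w).
transitivity (\int[mrestr P mA]_(w in phi @^-1` setT) (g \o phi) w)%E => //.
rewrite -push.
transitivity (c%:num%:E * \int[P]_(w in phi @^-1` setT) (g \o phi) w)%E => //.
rewrite -push -ge0_integral_mscale //.
apply: eq_measure_integral => B mB _.
rewrite /mscale /pushforward /= /mrestr; apply: PA.
by move: mB; rewrite /measurable /= sigma_algebra_id.
Qed.

End SubSigmaAlgebra.

(** * Exponential supermartingales *)

Section Signs.
Context d (Omega : measurableType d) (R : realType) (P : probability Omega R).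
Variables (X : normedModType R) (N : nat) (F : nat -> set (set Omega)).
Implicit Types (e : nat -> Omega -> R) (b : nat -> Omega -> X).

(** Independence is kept only as two identities for the level sets of the sign, and the values are
    prescribed everywhere rather than almost surely, so that the sample space splits exactly into
    two events. *)
Definition predictable_signs e := forall i, (1 <= i <= N)%N ->
  [/\ forall w, e i w = 1 \/ e i w = -1,
      adapted_to (F i) (e i),
      forall E, F i.-1 E ->
        P (E `&` e i @^-1` [set 1]) = ((2^-1)%:E * P E)%E &
      forall E, F i.-1 E ->
        P (E `&` e i @^-1` [set (-1)]) = ((2^-1)%:E * P E)%E].

Definition predictable b := forall i, (1 <= i <= N)%N -> adapted_to (F i.-1) (b i).

Definition transform e b n w : X := \sum_(1 <= i < n.+1) e i w *: b i w.

Definition square_sum b n w : R := \sum_(1 <= i < n.+1) `|b i w| ^+ 2.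

Definition exp_process (l D : R) e b n w : R :=
  cosh (l * `|transform e b n w|) *
  expR (- (l ^+ 2 * D ^+ 2 * square_sum b n w / 2)).

Lemma transformS e b n w :
  transform e b n.+1 w = transform e b n w + e n.+1 w *: b n.+1 w.
Proof. by rewrite /transform big_nat_recr. Qed.

Lemma square_sumS b n w :
  square_sum b n.+1 w = square_sum b n w + `|b n.+1 w| ^+ 2.
Proof. by rewrite /square_sum big_nat_recr. Qed.

Lemma exp_process_ge0 l D e b n w : 0 <= exp_process l D e b n w.
Proof. by rewrite mulr_ge0 ?expR_ge0// ltW ?cosh_gt0. Qed.

Hypothesis sepX : separable X.
Hypothesis filtF : filtration N F.

Lemma filtration_sub i j : (i <= j)%N -> (j <= N)%N -> F i `<=` F j.
Proof. by case: filtF => _ [_ H] ij jN; apply: H; rewrite ij. Qed.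

Lemma filtration_sub_measurable i : (i <= N)%N -> F i `<=` measurable.
Proof. by case: filtF => _ [H _] /H. Qed.

Lemma adaptedD G (f g : Omega -> X) :
  adapted_to G f -> adapted_to G g -> adapted_to G (fun w => f w + g w).
Proof.
move=> mf mg; have H := borel_fun_comp2 sepX sepX (@add_continuous X) mf mg.
exact H.
Qed.

Lemma adaptedZ G (c : Omega -> R) (f : Omega -> X) :
  adapted_to G c -> adapted_to G f -> adapted_to G (fun w => c w *: f w).
Proof.
move=> mc mf.
exact: (borel_fun_comp2 (@separable_real R : @separable R^o) sepX
  (@scale_continuous _ X) mc mf).
Qed.

Lemma adapted_norm G (f : Omega -> X) : adapted_to G f ->
  measurable_fun setT ((fun w => `|f w|) : g_sigma_algebraType G -> R).
Proof.
by move=> mf; apply/borel_funP; apply: (borel_fun_comp (@norm_continuous _ X)).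
Qed.

Lemma adapted_transform e b n :
  (forall i, (1 <= i <= N)%N -> adapted_to (F i) (e i)) -> predictable b ->
  (n <= N)%N -> adapted_to (F n) (transform e b n).
Proof.
move=> he hb; elim: n => [|n IH] nN.
  rewrite (_ : transform e b 0 = fun=> 0); first exact: adapted_cst.
  by apply/funext => w; rewrite /transform big_geq.
rewrite (_ : transform e b n.+1 =
  fun w => transform e b n w + e n.+1 w *: b n.+1 w); last first.
  by apply/funext => w; exact: transformS.
have me := he n.+1 nN.
apply: adaptedD.
  by apply: (adapted_sub (filtration_sub (leqnSn n) nN)); exact: IH (ltnW nN).
apply: adaptedZ => //.
by apply: (adapted_sub (filtration_sub (leqnSn n) nN)); exact: hb n.+1 nN.
Qed.

(** The number of summands may exceed the time m by one because the summands are predictable: the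
    compensator of the next step is already known. *)
Lemma measurable_square_sum b n m : predictable b -> (n <= N)%N ->
  (n <= m.+1)%N -> (m <= N)%N ->
  measurable_fun setT (square_sum b n : g_sigma_algebraType (F m) -> R).
Proof.
move=> hb; elim: n => [|n IH] nN nm mN.
  rewrite (_ : square_sum b 0 = fun=> 0); first exact: measurable_cst.
  by apply/funext => w; rewrite /square_sum big_geq.
rewrite (_ : square_sum b n.+1 =
  fun w => square_sum b n w + `|b n.+1 w| ^+ 2); last first.
  by apply/funext => w; exact: square_sumS.
apply: measurable_funD; first by apply: IH => //; exact: ltnW.
apply: measurable_funX; apply: adapted_norm.
by apply: (adapted_sub (@filtration_sub n m _ _)) => //; exact: hb n.+1 nN.
Qed.

Lemma measurable_cosh : measurable_fun setT (@cosh R).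
Proof. by apply: continuous_measurable_fun; exact: continuous_cosh. Qed.

Lemma measurable_exp_step G l (k : R) (f : Omega -> X) (q : Omega -> R) :
  adapted_to G f ->
  measurable_fun setT (q : g_sigma_algebraType G -> R) ->
  measurable_fun setT ((fun w => cosh (l * `|f w|) * expR (- (k * q w / 2)))
    : g_sigma_algebraType G -> R).
Proof.
move=> mf mq; apply: measurable_funM.
  apply: (measurableT_comp measurable_cosh).
  by apply: measurable_funM => //; exact: adapted_norm.
apply: (measurableT_comp (@measurable_expR R)); apply: measurable_funN.
by do 2 apply: measurable_funM => //.
Qed.

Lemma adapted_signs e : predictable_signs e ->
  forall i, (1 <= i <= N)%N -> adapted_to (F i) (e i).
Proof. by move=> he i iN; have [] := he i iN. Qed.

Lemma measurable_exp_process l D e b n :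
  predictable_signs e -> predictable b -> (n <= N)%N ->
  measurable_fun setT
    (exp_process l D e b n : g_sigma_algebraType (F n) -> R).
Proof.
move=> he hb nN; apply: measurable_exp_step.
  exact: adapted_transform (adapted_signs he) hb nN.
exact: measurable_square_sum.
Qed.

Lemma sub_measurable_fun d' (Y : measurableType d') G (f : Omega -> Y) :
  G `<=` measurable -> measurable_fun setT (f : g_sigma_algebraType G -> Y) ->
  measurable_fun setT f.
Proof.
move=> Gm mf _ B mB; have := mf measurableT B mB; rewrite !setTI.
by apply: smallest_sub => //; exact: sigma_algebra_measurable.
Qed.

(** The integral is split along the two values of the next sign instead of forming a conditional
    expectation. Each part is half the integral of an [F n]-measurable function, and the mean of
    these two functions is bounded pointwise by [smooth2_cosh]. *)
Lemma exp_process_step l D e b n : 1 <= D -> smooth2 X D ->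
  predictable_signs e -> predictable b -> (n < N)%N ->
  (\int[P]_w (exp_process l D e b n.+1 w)%:E <=
   \int[P]_w (exp_process l D e b n w)%:E)%E.
Proof.
move=> D1 smX he hb nN; have [e1 me Pp Pm] := he n.+1 nN.
pose S := transform e b n; pose Q := square_sum b n.+1.
pose k := l ^+ 2 * D ^+ 2.
have mS : adapted_to (F n) S.
  exact: adapted_transform (adapted_signs he) hb (ltnW nN).
have mb : adapted_to (F n) (b n.+1) by exact: hb n.+1 nN.
have mQ : measurable_fun setT (Q : g_sigma_algebraType (F n) -> R).
  by apply: measurable_square_sum => //; exact: ltnW.
(* The process at time n + 1 with the new sign frozen at s; everything in it is known at time n. *)
pose G (s : R) w := cosh (l * `|S w + s *: b n.+1 w|) * expR (- (k * Q w / 2)).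
have G0 s w : (0 <= (G s w)%:E)%E.
  by rewrite lee_fin mulr_ge0 ?expR_ge0// ltW ?cosh_gt0.
have mG s : measurable_fun setT
    ((fun w => (G s w)%:E) : g_sigma_algebraType (F n) -> \bar R).
  apply/measurable_EFinP; apply: measurable_exp_step => //.
  by apply: adaptedD => //; apply: adaptedZ => //; exact: adapted_cst.
have FnO : F n `<=` measurable by exact: filtration_sub_measurable (ltnW nN).
have mGO s : measurable_fun setT (fun w => (G s w)%:E).
  exact: sub_measurable_fun (mG s).
have sFn : sigma_algebra setT (F n) by case: filtF => H _; exact: H (ltnW nN).
have meO : measurable_fun setT (e n.+1).
  by apply/borel_funP; apply: adapted_borel me; exact: filtration_sub_measurable.
have mA s : measurable (e n.+1 @^-1` [set s]).
  by rewrite -[_ @^-1` _]setTI; exact: meO.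
have split_sign : [set: Omega] =
    e n.+1 @^-1` [set 1] `|` e n.+1 @^-1` [set (-1)].
  by apply/seteqP; split => // w _; case: (e1 w) => ?; [left|right].
have mE : measurable_fun setT (fun w => (exp_process l D e b n.+1 w)%:E).
  apply: (sub_measurable_fun (filtration_sub_measurable nN)).
  by apply/measurable_EFinP; exact: measurable_exp_process.
have half s : (forall E, F n E ->
      P (E `&` e n.+1 @^-1` [set s]) = ((2^-1)%:E * P E)%E) ->
    (\int[P]_(w in e n.+1 @^-1` [set s]) (exp_process l D e b n.+1 w)%:E =
     (2^-1)%:E * \int[P]_w (G s w)%:E)%E.
  move=> Ps; have h0 : 0 <= 2^-1 :> R by [].
  rewrite -[RHS](integral_independent (c := NngNum h0) FnO sFn (mA s) Ps
    (mG s) (G0 s)).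
  apply: eq_integral => w; rewrite inE /= => es.
  by rewrite /exp_process transformS es.
rewrite [in leLHS]split_sign ge0_integral_setU //; last 3 first.
- by rewrite -split_sign.
- by move=> w _; rewrite lee_fin exp_process_ge0.
- apply/disj_set2P/seteqP; split => // w [/= -> /eqP].
  by rewrite -subr_eq0 opprK -(natrD _ 1 1) pnatr_eq0.
rewrite !half // -ge0_muleDr ?integral_ge0 // -ge0_integralD //.
have mGG : measurable_fun setT (fun w => (G 1 w)%:E + (G (-1) w)%:E)%E.
  exact: emeasurable_funD.
have GG0 w : [set: Omega] w -> (0 <= (G 1 w)%:E + (G (-1) w)%:E)%E.
  by move=> _; exact: adde_ge0.
rewrite -ge0_integralZl //.
apply: ge0_le_integral => //.
- by move=> w _; apply: mule_ge0; [rewrite lee_fin|exact: GG0].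
- exact: measurable_funeM.
- apply: (sub_measurable_fun FnO).
  by apply/measurable_EFinP; apply: measurable_exp_process => //; exact: ltnW.
- move=> w _; rewrite -EFinD -EFinM lee_fin /G scale1r scaleN1r -mulrDl.
  rewrite /exp_process -/(S w) /Q square_sumS.
  rewrite (_ : - (k * (square_sum b n w + `|b n.+1 w| ^+ 2) / 2) =
    - (k * `|b n.+1 w| ^+ 2 / 2) - k * square_sum b n w / 2); last by ring.
  have := smooth2_cosh l (S w) (b n.+1 w) D1 smX; rewrite -/k.
  move: (cosh _ + cosh _) => C H; rewrite expRD expRN.
  have F0 := expR_gt0 (k * `|b n.+1 w| ^+ 2 / 2).
  move: (expR (k * `|b n.+1 w| ^+ 2 / 2)) F0 H => f f0 H.
  rewrite (_ : 2^-1 * _ = C / (2 * f) * expR (- (k * square_sum b n w / 2))).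
    by rewrite ler_wpM2r ?expR_ge0// ler_pdivrMr ?mulr_gt0//; lra.
  by field; rewrite gt_eqF.
Qed.

Lemma exp_process_le1 l D e b n : 1 <= D -> smooth2 X D ->
  predictable_signs e -> predictable b -> (n <= N)%N ->
  (\int[P]_w (exp_process l D e b n w)%:E <= 1)%E.
Proof.
move=> D1 smX he hb; elim: n => [|n IH] nN.
  rewrite (eq_integral (cst 1%E)).
    by rewrite integral_cst// mul1e probability_le1.
  move=> w _; rewrite /exp_process /transform /square_sum !big_geq//.
  by rewrite normr0 !mulr0 mul0r oppr0 expR0 cosh0 mulr1.
exact: (le_trans (exp_process_step _ D1 smX he hb nN)) (IH (ltnW nN)).
Qed.

(* Off A the process stays at its initial value 1. *)
Lemma exp_process_on l D e b (A : set Omega) : 1 <= D -> smooth2 X D ->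
  predictable_signs e -> predictable b -> measurable A ->
  (forall i w, (1 <= i <= N)%N -> ~ A w -> b i w = 0) ->
  (\int[P]_(w in A) (exp_process l D e b N w)%:E <= P A)%E.
Proof.
move=> D1 smX he hb mA bA0.
have mE : measurable_fun setT (fun w => (exp_process l D e b N w)%:E).
  apply: (sub_measurable_fun (filtration_sub_measurable (leqnn N))).
  by apply/measurable_EFinP; exact: measurable_exp_process.
have E0 w : (0 <= (exp_process l D e b N w)%:E)%E.
  by rewrite lee_fin exp_process_ge0.
(* The integral over the whole space is at most 1 and the complement of A contributes exactly its
   probability. Thus A may be an event known only at the final time. *)
have := exp_process_le1 l D1 smX he hb (leqnn N).
rewrite -(setUv A) ge0_integral_setU //; last 3 first.
- exact: measurableC.
- by rewrite setUv.
- by apply/disj_set2P; rewrite setICr.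
rewrite [X in (_ + X)%E](_ : _ = P (~` A)); last first.
  rewrite (eq_integral (cst 1%E)).
    by rewrite integral_cst ?mul1e//; exact: measurableC.
  move=> w; rewrite inE /= => nAw.
  rewrite /exp_process /transform /square_sum !big1_seq.
  - by rewrite normr0 !mulr0 mul0r oppr0 expR0 cosh0 mulr1.
  - move=> i; rewrite mem_index_iota ltnS => /andP[_ iN].
    by rewrite bA0 // normr0 expr0n.
  - move=> i; rewrite mem_index_iota ltnS => /andP[_ iN].
    by rewrite bA0 // scaler0.
rewrite probability_setC // => H.
have PAf : P A \is a fin_num by exact: fin_num_measure.
rewrite -leeBrDr in H; last by rewrite fin_numB PAf.
apply: (le_trans H); rewrite oppeB ?fin_num_adde_defr//.
by rewrite addeA subee// add0e.
Qed.

End Signs.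

(** * Balls, entropy and Gamma *)

Section BigMax.
Variables (R : realType) (T : finType).

Lemma bigmax2_leP (F : T -> T -> R) (c : R) : 0 <= c ->
  reflect (forall t u, F t u <= c)
    (\big[Num.max/0]_(t : T) \big[Num.max/0]_(u : T) F t u <= c).
Proof.
move=> c0; apply: (iffP idP) => [/bigmax_leP[_ H] t u|H].
  by have /bigmax_leP[_ ->] := H t isT.
by apply/bigmax_leP; split=> // t _; apply/bigmax_leP.
Qed.

Lemma bigmax2_ge0 (F : T -> T -> R) :
  0 <= \big[Num.max/0]_(t : T) \big[Num.max/0]_(u : T) F t u.
Proof. exact: bigmax_ge_id. Qed.

Lemma le_bigmax2 (F : T -> T -> R) t u :
  F t u <= \big[Num.max/0]_(t : T) \big[Num.max/0]_(u : T) F t u.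
Proof. exact: (bigmax2_leP _ (bigmax2_ge0 F)). Qed.

Lemma diam_ge0 (d : T -> T -> R) : 0 <= diam d. Proof. exact: bigmax2_ge0. Qed.

Lemma le_diam (d : T -> T -> R) t u : d t u <= diam d.
Proof. exact: le_bigmax2. Qed.

Lemma diam_leP (d : T -> T -> R) c : 0 <= c ->
  reflect (forall t u, d t u <= c) (diam d <= c).
Proof. exact: bigmax2_leP. Qed.

Lemma diam_mono (d d' : T -> T -> R) : (forall t u, d t u <= d' t u) ->
  diam d <= diam d'.
Proof.
move=> dd; apply/diam_leP => [|t u]; first exact: diam_ge0.
exact: le_trans (dd t u) (le_diam _ _ _).
Qed.

Variable X : normedModType R.
Implicit Type f : T -> X.

Lemma osc_ge0 f : 0 <= osc f. Proof. exact: bigmax2_ge0. Qed.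

Lemma le_osc f t u : `|f t - f u| <= osc f.
Proof. exact: (le_bigmax2 (fun t u => `|f t - f u|)). Qed.

Lemma osc_leP f c : 0 <= c ->
  reflect (forall t u, `|f t - f u| <= c) (osc f <= c).
Proof. exact: bigmax2_leP. Qed.

Lemma osc_triangle f g : osc (fun t => f t + g t) <= osc f + osc g.
Proof.
apply/osc_leP => [|t u]; first by rewrite addr_ge0 ?osc_ge0.
rewrite opprD addrACA (le_trans (ler_normD _ _))// lerD ?le_osc//.
Qed.

End BigMax.

Section FiniteProbability.
Variables (R : realType) (T : finType) (mu : {set T} -> R).
Hypothesis mu_prob : finite_probability mu.
Hypothesis mu_pos : forall t : T, 0 < mu [set t]%SET.
Implicit Types (A B : {set T}) (d : T -> T -> R).

Lemma finite_probabilityE A : mu A = \sum_(t in A) mu [set t]%SET.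
Proof.
have [_ _ muU] := mu_prob.
have mu0 : mu finset.set0 = 0.
  have := muU finset.set0 finset.set0; rewrite finset.setI0 => /(_ erefl).
  by rewrite finset.setU0; lra.
elim: {A}#|A| {-2}A (leqnn #|A|) => [|n IH] A.
  by rewrite leqn0 cards_eq0 => /eqP ->; rewrite mu0 big_set0.
have [->|[t tA]] := set_0Vmem A; first by rewrite mu0 big_set0.
move=> An; rewrite (big_setD1 t tA) /= -IH.
  rewrite -muU ?finset.setD1K//.
  by apply/setP => x; rewrite !inE; case: eqP.
by move: An; rewrite (cardsD1 t) tA.
Qed.

Lemma finite_probability_gt0 A t : t \in A -> 0 < mu A.
Proof.
move=> tA; rewrite finite_probabilityE (big_setD1 t tA) /= ltr_pwDl//.
by apply: sumr_ge0 => u _; exact: ltW.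
Qed.

Lemma finite_probability_mono A B : A \subset B -> mu A <= mu B.
Proof.
move=> AB; rewrite !finite_probabilityE.
rewrite (big_mkcond (mem A)) (big_mkcond (mem B)) /=; apply: ler_sum => t _.
by case: ifPn => [/(fintype.subsetP AB) ->//|_]; case: ifPn => // _; exact: ltW.
Qed.

Definition ell A : R := Num.sqrt (ln (expR 1 / mu A)).

Lemma ln_ell A t : t \in A -> ln (expR 1 / mu A) = 1 - ln (mu A).
Proof.
by move=> /finite_probability_gt0 A0; rewrite ln_div ?posrE ?expR_gt0// expRK.
Qed.

Lemma ln_finite_probability_le0 A : ln (mu A) <= 0.
Proof.
apply: ln_le0; have [_ <- _] := mu_prob; apply: finite_probability_mono.
exact: finset.subsetT.
Qed.

Lemma ell_ge0 A : 0 <= ell A. Proof. exact: sqrtr_ge0. Qed.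

Lemma ell_ge1 A t : t \in A -> 1 <= ell A.
Proof.
move=> tA; rewrite -[leLHS]sqrtr1 ler_wsqrtr// (ln_ell tA).
by rewrite lerDl oppr_ge0 ln_finite_probability_le0.
Qed.

Lemma ell_sqr A t : t \in A -> (mu A)^-1 = expR (ell A ^+ 2 - 1).
Proof.
move=> tA; rewrite sqr_sqrtr (ln_ell tA).
  by rewrite addrAC subrr add0r expRN lnK// posrE (finite_probability_gt0 tA).
by rewrite subr_ge0 (le_trans (ln_finite_probability_le0 A)).
Qed.

Lemma ell_anti A B t : t \in A -> A \subset B -> ell B <= ell A.
Proof.
move=> tA AB; apply: ler_wsqrtr.
rewrite (ln_ell tA) (ln_ell (fintype.subsetP AB _ tA)) lerD2l lerN2.
rewrite ler_ln ?posrE ?(finite_probability_gt0 tA)//.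
  exact: finite_probability_mono.
exact: finite_probability_gt0 (fintype.subsetP AB _ tA).
Qed.

Lemma ellT : ell [set: T] = 1.
Proof. by have [_ m1 _] := mu_prob; rewrite /ell m1 divr1 expRK sqrtr1. Qed.

(** Both the metric and the radius may vary with s: a fixed metric serves the integrals over r, the
    joint form serves the measurability of [Gamma]. *)
Lemma measurable_ell dS (S : measurableType dS) (ds : S -> T -> T -> R)
    (rho : S -> R) (t : T) :
  (forall u, measurable_fun setT (fun s => ds s t u)) ->
  measurable_fun setT rho ->
  measurable_fun setT (fun s => ell (pball (ds s) t (rho s))).
Proof.
move=> md mrho; apply: (measurableT_comp (f := @Num.sqrt R)).
  by apply: continuous_measurable_fun; exact: sqrt_continuous.
apply: (measurableT_comp (@measurable_ln R)); apply: measurable_funM => //.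
have [mu0 _ _] := mu_prob.
rewrite (_ : (fun s => _) = fun s => (mu (pball (ds s) t (rho s))) `^ (-1)).
  apply: (measurableT_comp (measurable_powR _)).
  rewrite (_ : (fun s => _) = fun s => \sum_(u : T)
      (if ds s t u <= rho s then mu [set u]%SET else 0)); last first.
    apply/funext => s; rewrite finite_probabilityE big_mkcond /=.
    by apply: eq_bigr => u _; rewrite inE.
  apply: measurable_sum => u; apply: measurable_fun_ifT => //.
  exact: measurable_fun_ler.
by apply/funext => s; rewrite powR_inv1.
Qed.

Lemma pball_refl d t r : d t t = 0 -> 0 <= r -> t \in pball d t r.
Proof. by move=> d0 r0; rewrite inE d0. Qed.

Lemma pballS d t r r' : r <= r' -> pball d t r \subset pball d t r'.
Proof. by move=> rr; apply/fintype.subsetP => u; rewrite !inE => /le_trans; apply. Qed.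

Lemma Gamma_ge t d :
  (\int[@lebesgue_measure R]_(r in `[0%R, diam d]%classic)
     (ell (pball d t r))%:E <= Gamma mu d)%E.
Proof. by apply: ereal_sup_ubound; exists t. Qed.

Lemma Gamma_leP d (c : \bar R) :
  (forall t, (\int[@lebesgue_measure R]_(r in `[0%R, diam d]%classic)
     (ell (pball d t r))%:E <= c)%E) -> (Gamma mu d <= c)%E.
Proof. by move=> H; apply: ge_ereal_sup => _ [t _ <-]; exact: H. Qed.

Lemma measurable_ell_radius d t (D : set R) :
  measurable_fun D (fun r : R => (ell (pball d t r))%:E).
Proof.
apply: measurable_funTS; apply/measurable_EFinP.
by apply: (@measurable_ell _ R (fun=> d) id) => // u; exact: measurable_cst.
Qed.

(** A larger metric has smaller balls and a longer range of integration. *)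
Lemma Gamma_mono d d' : (forall t, d t t = 0) -> (forall t, d' t t = 0) ->
  (forall t u, d t u <= d' t u) -> (Gamma mu d <= Gamma mu d')%E.
Proof.
move=> d0 d'0 dd; apply: Gamma_leP => t; apply: le_trans (Gamma_ge t d').
apply: (@le_trans _ _ (\int[@lebesgue_measure R]_(r in `[0%R, diam d]%classic)
     (ell (pball d' t r))%:E)%E).
  apply: ge0_le_integral => //; try exact: measurable_ell_radius.
  - by move=> r _; rewrite lee_fin ell_ge0.
  - move=> r /=; rewrite in_itv /= => /andP[r0 _]; rewrite lee_fin.
    apply: (@ell_anti _ _ t); first exact: pball_refl.
    by apply/fintype.subsetP => u; rewrite !inE; apply: le_trans.
apply: ge0_subset_integral => //; first exact: measurable_ell_radius.
  by move=> r _; rewrite lee_fin ell_ge0.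
move=> r /=; rewrite !in_itv /= => /andP[-> /=] /le_trans; apply.
exact: diam_mono.
Qed.

Lemma Gamma_lty d : (Gamma mu d < +oo)%E.
Proof.
(* T has finitely many subsets, so the sum of [ell] over all of them dominates the integrand at
   every radius. *)
pose M : R := \sum_(A : {set T}) ell A.
apply: (@le_lt_trans _ _ (M%:E * (diam d)%:E)%E); last by rewrite -EFinM ltry.
apply: Gamma_leP => t.
apply: (@le_trans _ _ (\int[@lebesgue_measure R]_(r in `[0%R, diam d]%classic)
     M%:E)%E).
  apply: ge0_le_integral => //; try exact: measurable_ell_radius.
  - by move=> r _; rewrite lee_fin ell_ge0.
  - move=> r _; rewrite lee_fin /M (bigD1 (pball d t r)) //= lerDl.
    by rewrite sumr_ge0// => A _; exact: ell_ge0.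
rewrite integral_cst//= lebesgue_measure_itv /=; case: ifPn => [_|].
  by rewrite oppr0 addr0.
rewrite lte_fin -leNgt => dm; rewrite mule0 -EFinM lee_fin mulr_ge0 ?diam_ge0//.
by rewrite sumr_ge0// => A _; exact: ell_ge0.
Qed.

Lemma Gamma_ge0 d : (0 < #|T|)%N -> (0 <= Gamma mu d)%E.
Proof.
move=> /card_gt0P[t _]; apply: le_trans (Gamma_ge t d).
by apply: integral_ge0 => r _; rewrite lee_fin ell_ge0.
Qed.

(* Beyond the diameter the balls are all of T, and ell is 1 there. *)
Lemma integral_ell_le d t (Dl : R) : 0 <= Dl -> diam d <= Dl ->
  (\int[@lebesgue_measure R]_(r in `[0%R, Dl]%classic) (ell (pball d t r))%:E
   <= Gamma mu d + Dl%:E)%E.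
Proof.
move=> Dl0 dDl; have d0 := diam_ge0 d.
have -> : `[0%R, Dl]%classic = `[0%R, diam d]%classic `|` `]diam d, Dl]%classic.
  apply/seteqP; split=> r /=; rewrite !in_itv /=.
    by move=> /andP[-> ->]; rewrite andbT; case: (leP r (diam d)) => H;
      [left|right].
  by case=> /andP[H1 H2]; apply/andP; split => //; [exact: le_trans dDl|
    exact: le_trans (ltW H1)].
rewrite ge0_integral_setU //; last 3 first.
- exact: measurable_ell_radius.
- by move=> r _; rewrite lee_fin ell_ge0.
- apply/disj_set2P/seteqP; split => // r [/=]; rewrite !in_itv /=.
  by move=> /andP[_ H1] /andP[]; rewrite ltNge H1.
apply: leeD; first exact: Gamma_ge.
rewrite (eq_integral (cst 1%E)).
  rewrite integral_cst//= mul1e lebesgue_measure_itv /=; case: ifPn => _.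
    by rewrite lee_fin gerBl.
  by rewrite lee_fin.
move=> r; rewrite inE /= in_itv /= => /andP[H _].
rewrite (_ : pball d t r = [set: T]%SET) ?ellT//.
by apply/setP => u; rewrite !inE (le_trans (le_diam d t u) (ltW H)).
Qed.

(** A dyadic lower sum: between the radii Dl / 2^(k+2) and Dl / 2^(k+1), an interval of length Dl /
    2^(k+2), [ell] is at least its value at the right end. *)
Lemma sum_ell_le_integral d t (Dl : R) (K : nat) : d t t = 0 -> 0 < Dl ->
  ((\sum_(k < K) Dl / 2 ^+ k.+2 * ell (pball d t (Dl / 2 ^+ k.+1)))%R%:E <=
   \int[@lebesgue_measure R]_(r in `](Dl / 2 ^+ K.+1)%R, (Dl / 2)%R]%classic)
     (ell (pball d t r))%:E)%E.
Proof.
move=> d0 Dl0; elim: K => [|K IH].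
  by rewrite big_ord0; apply: integral_ge0 => r _; rewrite lee_fin ell_ge0.
have p0 n : 0 < Dl / 2 ^+ n by rewrite divr_gt0// exprn_gt0.
have half n : Dl / 2 ^+ n.+1 < Dl / 2 ^+ n.
  by rewrite ltr_pM2l// ltf_pV2 ?posrE ?exprn_gt0// exprS ltr_pMl ?exprn_gt0// ltr1n.
have dec n : Dl / 2 ^+ n.+1 <= Dl / 2.
  by rewrite ler_pM2l// lef_pV2 ?posrE ?exprn_gt0// exprS ler_peMr// exprn_ege1// ler1n.
have -> : `]Dl / 2 ^+ K.+2, Dl / 2]%classic =
   `]Dl / 2 ^+ K.+1, Dl / 2]%classic `|` `]Dl / 2 ^+ K.+2, Dl / 2 ^+ K.+1]%classic.
  apply/seteqP; split=> r /=; rewrite !in_itv /=.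
    by move=> /andP[-> ->]; rewrite andbT; case: (leP r (Dl / 2 ^+ K.+1)) => H;
      [right|left].
  case=> /andP[H1 H2]; apply/andP; split => //.
    exact: lt_trans (half _) H1.
  exact: le_trans H2 (dec _).
rewrite ge0_integral_setU //; last 3 first.
- exact: measurable_ell_radius.
- by move=> r _; rewrite lee_fin ell_ge0.
- apply/disj_set2P/seteqP; split => // r [/=]; rewrite !in_itv /=.
  by move=> /andP[H1 _] /andP[_]; rewrite leNgt H1.
rewrite big_ord_recr /= EFinD; apply: leeD => //.
apply: (@le_trans _ _ (\int[@lebesgue_measure R]_(r in
    `](Dl / 2 ^+ K.+2)%R, (Dl / 2 ^+ K.+1)%R]%classic)
     (ell (pball d t (Dl / 2 ^+ K.+1)%R))%:E)%E); last first.
  apply: ge0_le_integral => //; try exact: measurable_ell_radius.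
  - by move=> r _; rewrite lee_fin ell_ge0.
  - move=> r /=; rewrite in_itv /= => /andP[r0 rK]; rewrite lee_fin.
    apply: (@ell_anti _ _ t); last exact: pballS.
    by apply: pball_refl => //; exact: ltW (lt_trans (p0 _) r0).
rewrite integral_cst//= lebesgue_measure_itv /= lte_fin half -EFinB -EFinM.
rewrite lee_fin mulrC ler_wpM2l ?ell_ge0//.
rewrite [in leRHS](_ : Dl / 2 ^+ K.+1 = Dl / 2 ^+ K.+2 *+ 2); first by lra.
by rewrite [in RHS]exprS invfM -mulr_natr; field; rewrite expf_neq0.
Qed.

End FiniteProbability.

(** * Chaining by ball averages *)

Section Chaining.
Variables (R : realType) (T : finType) (mu : {set T} -> R).
Hypothesis mu_prob : finite_probability mu.
Hypothesis mu_pos : forall t : T, 0 < mu [set t]%SET.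
Variables (d g : T -> T -> R) (D Dl s : R).
Hypotheses (D0 : 0 < D) (Dl0 : 0 < Dl) (s1 : 1 <= s).
Hypotheses (dxx : forall t, d t t = 0) (dC : forall t u, d t u = d u t)
  (d_triangle : forall t u v, d t v <= d t u + d u v)
  (dDl : forall t u, d t u <= Dl).
Hypotheses (gC : forall t u, g t u = g u t)
  (g_triangle : forall t u v, g t v <= g t u + g u v)
  (gd0 : forall t u, d t u <= 0 -> g t u = 0).

Local Notation w t := (mu [set t]%SET).
Let r k : R := Dl / 2 ^+ k.
Let B k t := pball d t (r k).

Definition pair_exp (l : R) (u v : T) : R :=
  cosh (l * g u v) * expR (- (l ^+ 2 * D ^+ 2 * d u v ^+ 2 / 2)).

(** The good event, in a section free of probability. Markov's inequality will bound the failure at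
    (k, n) with a weight exp(- s^2) 2^-(k+n+2), summable over both indices. *)
Hypothesis pair_exp_le : forall k n,
  \sum_u \sum_v w u * w v * pair_exp (n.+1%:R / (D * r k)) u v <=
  expR (s ^+ 2) * 2 ^+ (k + n + 2).

Let r_gt0 k : 0 < r k. Proof. by rewrite divr_gt0// exprn_gt0. Qed.
Let B_refl k t : t \in B k t. Proof. by rewrite inE dxx ltW. Qed.
Let w_ge0 t : 0 <= w t. Proof. exact: ltW. Qed.

Let muB k t : 0 < mu (B k t).
Proof. exact: (finite_probability_gt0 mu_prob mu_pos (B_refl k t)). Qed.

Let rS k : r k.+1 <= r k.
Proof.
rewrite ler_pM2l// lef_pV2 ?posrE ?exprn_gt0// exprS.
by rewrite ler_peMl ?exprn_ge0// ler1n.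
Qed.

Let chain_edge k t : R :=
  \sum_(u in B k t) \sum_(v in B k.+1 t) w u * w v * g u v.

(** The chain runs through means over whole balls rather than through points of nets; this is what
    lets the mu x mu average control every link. *)
Let ball_avg k t : R := \sum_(u in B k t) w u * g u t / mu (B k t).

Let pair_exp_ge0 l u v : 0 <= pair_exp l u v.
Proof. by rewrite mulr_ge0 ?expR_ge0// ltW ?cosh_gt0. Qed.

(* A linearised Jensen inequality: y <= c - 1 + e^(y - c) for y = l g u v. *)
Let edge_pointwise k (q l c : R) t u v : u \in B k t -> v \in B k.+1 t ->
  l = q / (D * r k) ->
  l * g u v <= c - 1 + expR (- c) * (2 * expR (2 * q ^+ 2)) * pair_exp l u v.
Proof.
move=> uB vB lE; have duv : d u v <= 2 * r k.
  move: uB vB; rewrite !inE => uB vB; have := d_triangle u t v.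
  by rewrite (dC u t) => /le_trans; apply; have := rS k; lra.
have duv0 : 0 <= d u v.
  by have := d_triangle u v u; rewrite dxx (dC v u); lra.
(* Undoing the compensator costs at most exp(2 q^2), since l D = q / r k and d u v <= 2 r k;
   moreover e^y <= 2 cosh y. *)
have lg : expR (l * g u v) <= 2 * expR (2 * q ^+ 2) * pair_exp l u v.
  apply: (le_trans (expR_le_cosh _)); rewrite -mulrA ler_pM2l//.
  rewrite /pair_exp mulrCA ler_peMr ?(ltW (cosh_gt0 _))// -expRD.
  rewrite -[leLHS]expR0 ler_expR.
  have -> : l ^+ 2 * D ^+ 2 * d u v ^+ 2 = q ^+ 2 * (d u v / r k) ^+ 2.
    by rewrite lE; field; rewrite !gt_eqF.
  have H : (d u v / r k) ^+ 2 <= 2 ^+ 2.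
    apply: lerXn2r; rewrite ?nnegrE//; last by rewrite ler_pdivrMr.
    by apply: divr_ge0 => //; exact: ltW.
  by have := ler_wpM2l (sqr_ge0 q) H; lra.
have H := expR_ge1Dx (l * g u v - c); rewrite -[leLHS](subrK (c - 1)) addrC.
rewrite lerD2l; apply: (@le_trans _ _ (expR (l * g u v - c))); first by lra.
by rewrite expRD mulrC -mulrA ler_wpM2l ?expR_ge0.
Qed.

Let exp_pow2 (m : nat) : 2 ^+ m <= expR m%:R :> R.
Proof.
rewrite -[m%:R]mulr1 expRM_natl lerXn2r ?nnegrE ?expR_ge0//.
exact: (le_trans _ (expR_ge1Dx 1)).
Qed.

(** Only integer multiples of 1 / (D r k) are available as l, so q is an integer between max(L, s)
    and L + s. Dividing c by q then makes every term linear: 2 q <= 2 L + 2 s, s^2 / q <= s, 2 L^2 /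
    q <= 2 L, k / q <= k and q / q = 1. *)
Let chain_edge_le k t : chain_edge k t <=
  D * r k * (4 * ell mu (B k.+1 t) + 3 * s + k%:R + 1) *
  (mu (B k t) * mu (B k.+1 t)).
Proof.
set L := ell mu _; set m := mu (B k t); set m' := mu (B k.+1 t).
have L1 : 1 <= L := ell_ge1 mu_prob mu_pos (B_refl k.+1 t).
have m0 : 0 < m := muB k t; have m'0 : 0 < m' := muB k.+1 t.
have m'm : m' <= m.
  by apply: finite_probability_mono => //; apply: pballS; exact: rS.
have [n [qL qs qLs]] : exists n : nat,
    [/\ L <= n.+1%:R, s <= n.+1%:R & n.+1%:R <= L + s].
  pose M := Num.max L s; have M0 : 0 <= M by rewrite le_max (le_trans _ L1).
  have /andP[H1 H2] := truncn_itv M0; exists (Num.truncn M).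
  have [LM sM] : L <= M /\ s <= M by rewrite !le_max !lexx orbT.
  split; [exact: le_trans LM (ltW H2)|exact: le_trans sM (ltW H2)|].
  rewrite -natr1 (le_trans (lerD H1 (lexx 1)))//.
  rewrite /M maxEle; case: ifP => _; first by rewrite addrC lerD2r.
  by rewrite lerD2l.
set q : R := n.+1%:R in qL qs qLs; pose l := q / (D * r k).
have q1 : 1 <= q by rewrite ler1n.
have l0 : 0 < l by rewrite divr_gt0 ?mulr_gt0//; lra.
(* The terms 2 q^2 and s^2 cancel the two exponentials, and k + q pays for 2^(k+n+3) up to e^2. What
   remains is exp(- 2 (L^2 - 1)), the square of the mass of the smaller ball, hence at most
   [m * m']. *)
pose c := 2 * q ^+ 2 + s ^+ 2 + 2 * L ^+ 2 + k%:R + q.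
have H1 : l * chain_edge k t <= (c - 1) * (m * m') +
    expR (- c) * (2 * expR (2 * q ^+ 2)) * (expR (s ^+ 2) * 2 ^+ (k + n + 2)).
  apply: (@le_trans _ _ ((c - 1) * (m * m') +
      expR (- c) * (2 * expR (2 * q ^+ 2)) *
      \sum_u \sum_v w u * w v * pair_exp l u v)); last first.
    rewrite lerD2l ler_wpM2l ?mulr_ge0 ?expR_ge0//; exact: pair_exp_le.
  have -> : m * m' = \sum_(u in B k t) \sum_(v in B k.+1 t) w u * w v.
    rewrite /m (finite_probabilityE mu_prob (B k t)) mulr_suml.
    apply: eq_bigr => u _; rewrite -mulr_sumr.
    by rewrite -(finite_probabilityE mu_prob (B k.+1 t)).
  set c' := expR (- c) * _; have c'0 : 0 <= c' by rewrite !mulr_ge0 ?expR_ge0.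
  apply: (@le_trans _ _ ((c - 1) * (\sum_(u in B k t) \sum_(v in B k.+1 t)
    w u * w v) + c' * \sum_(u in B k t) \sum_(v in B k.+1 t)
    w u * w v * pair_exp l u v)); last first.
    rewrite lerD2l ler_wpM2l// [leLHS]big_mkcond; apply: ler_sum => u _.
    case: ifP => _; last by apply: sumr_ge0 => v _; rewrite !mulr_ge0.
    rewrite [leLHS]big_mkcond; apply: ler_sum => v _.
    by case: ifP => _ //; rewrite !mulr_ge0.
  rewrite /chain_edge !mulr_sumr -big_split /=; apply: ler_sum => u uB.
  rewrite !mulr_sumr -big_split /=; apply: ler_sum => v vB.
  have H := edge_pointwise c uB vB (erefl l).
  by have := ler_wpM2l (mulr_ge0 (w_ge0 u) (w_ge0 v)) H; rewrite -/c'; lra.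
have H2 : expR (- c) * (2 * expR (2 * q ^+ 2)) *
    (expR (s ^+ 2) * 2 ^+ (k + n + 2)) <= m * m'.
  have e1 : m' = expR (- (L ^+ 2 - 1)).
    by rewrite expRN -(ell_sqr mu_prob mu_pos (B_refl k.+1 t)) invrK.
  apply: (@le_trans _ _ (m' * m')); last by rewrite ler_pM2r.
  have -> : m' * m' = expR (- c) * expR (2 * q ^+ 2) * expR (s ^+ 2)
      * expR (k + n + 3)%:R.
    rewrite {1 2}e1 -!expRD; congr expR; rewrite /c !natrD /q -natr1; lra.
  rewrite (_ : _ * _ * (_ * _) = expR (- c) * expR (2 * q ^+ 2) * expR (s ^+ 2)
    * 2 ^+ (k + n + 3)); last by rewrite (addnS _ 2) [2 ^+ _.+1]exprS; ring.
  by rewrite ler_wpM2l ?mulr_ge0 ?expR_ge0.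
have H3 : l * chain_edge k t <= c * (m * m') by lra.
rewrite -(ler_pM2l l0) (le_trans H3)// [leRHS]mulrA ler_pM2r ?mulr_gt0//.
have -> : l * (D * r k * (4 * L + 3 * s + k%:R + 1)) =
    q * (4 * L + 3 * s + k%:R + 1).
  by rewrite /l; field; rewrite !gt_eqF.
have K0 : 0 <= k%:R :> R by [].
rewrite /c; nra.
Qed.

(** The triangle inequality through v, averaged over u in the larger ball and v in the smaller
    one. *)
Let ball_avg_step k t : ball_avg k t <=
  D * r k * (4 * ell mu (B k.+1 t) + 3 * s + k%:R + 1) + ball_avg k.+1 t.
Proof.
have m0 := muB k t; have m'0 := muB k.+1 t.
rewrite -(ler_pM2r (mulr_gt0 m0 m'0)) mulrDl.
apply: le_trans (lerD (chain_edge_le k t) (lexx _)).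
rewrite /ball_avg /chain_edge !mulr_suml.
have -> : \sum_(u in B k t) w u * g u t / mu (B k t) *
    (mu (B k t) * mu (B k.+1 t)) =
    \sum_(u in B k t) \sum_(v in B k.+1 t) w u * w v * g u t.
  apply: eq_bigr => u _; rewrite mulrA divfK ?gt_eqF//.
  rewrite [in LHS](finite_probabilityE mu_prob (B k.+1 t)) mulr_sumr.
  by apply: eq_bigr => v _; ring.
have -> : \sum_(v in B k.+1 t) w v * g v t / mu (B k.+1 t) *
    (mu (B k t) * mu (B k.+1 t)) =
    \sum_(u in B k t) \sum_(v in B k.+1 t) w u * w v * g v t.
  rewrite exchange_big /=; apply: eq_bigr => v _.
  rewrite [mu (B k t) * _]mulrC mulrA divfK ?gt_eqF//.
  rewrite [in LHS](finite_probabilityE mu_prob (B k t)) mulr_sumr.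
  by apply: eq_bigr => u _; ring.
rewrite -big_split /=; apply: ler_sum => u _.
rewrite -big_split /=; apply: ler_sum => v _.
by rewrite -mulrDr ler_wpM2l ?mulr_ge0.
Qed.

Let ball_avg0 k t : (forall u, d t u <= r k -> d t u <= 0) -> ball_avg k t = 0.
Proof.
move=> H; rewrite /ball_avg big1// => u; rewrite inE => /H/gd0.
by rewrite gC => ->; rewrite mulr0 mul0r.
Qed.

Let geometric_sum (x : R) (K : nat) :
  \sum_(k < K) (x + k%:R) / 2 ^+ k =
  2 * x + 2 - (2 * x + 2 * K%:R + 2) / 2 ^+ K.
Proof.
elim: K => [|K IH]; first by rewrite big_ord0 expr0; lra.
rewrite big_ord_recr /= IH exprS -natr1; field.
by rewrite expf_neq0.
Qed.

Lemma chaining_avg (G : R) t : (Gamma mu d <= G%:E)%E ->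
  ball_avg 0 t <= D * (16 * G + 26 * (s * Dl)).
Proof.
(* As T is finite, a small enough ball contains only points at distance 0 from t, where g vanishes
   by [gd0] and the chain ends. The depth K depends on the metric, which is harmless because
   [pair_exp_le] covers every k. *)
move=> GG; have [K HK] : exists K, forall u, d t u <= r K -> d t u <= 0.
  have /fin_all_exists[Ku HKu] : forall u, exists K, forall k, (K <= k)%N ->
      d t u <= r k -> d t u <= 0.
    move=> u; have [d0|d0] := leP (d t u) 0; first by exists 0%N.
    have e0 : 0 < d t u / Dl by rewrite divr_gt0.
    have [n _ /(_ n (leqnn _)) ne] := near_infty_natSinv_lt (PosNum e0).
    exists n => k nk /le_lt_trans H; suff : d t u < d t u by rewrite ltxx.
    apply: H; rewrite /r -ltr_pdivlMl// mulrC; apply: le_lt_trans ne.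
    rewrite lef_pV2 ?posrE ?exprn_gt0// -natrX ler_nat.
    exact: (leq_trans (leq_ltn_trans nk (ltn_expl _ (leqnn 2)))).
  by exists (\max_u Ku u)%N => u; apply: HKu; exact: leq_bigmax.
have H1 : ball_avg 0 t <= \sum_(k < K)
    D * r k * (4 * ell mu (B k.+1 t) + 3 * s + k%:R + 1) + ball_avg K t.
  elim: K {HK} => [|K IH]; first by rewrite big_ord0 add0r.
  rewrite big_ord_recr /= -addrA (le_trans IH)// lerD2l.
  exact: ball_avg_step.
rewrite (ball_avg0 HK) addr0 in H1; apply: (le_trans H1).
(* Here 4 r k = 16 Dl / 2^(k+2) turns the [ell] terms into the dyadic lower sum. *)
have -> : \sum_(k < K) D * r k * (4 * ell mu (B k.+1 t) + 3 * s + k%:R + 1) =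
  D * (16 * (\sum_(k < K) Dl / 2 ^+ k.+2 * ell mu (B k.+1 t)) +
       Dl * \sum_(k < K) (3 * s + 1 + k%:R) / 2 ^+ k).
  rewrite [in RHS]mulr_sumr [X in _ = _ * (_ + X)]mulr_sumr -big_split /=.
  rewrite mulr_sumr; apply: eq_bigr => k _; rewrite /r !exprS; field.
  by rewrite expf_neq0.
rewrite ler_wpM2l ?(ltW D0)// geometric_sum.
(* The integral up to Dl exceeds the one up to the diameter by at most Dl. With 1 <= s the total is
   16 G + (16 + 4) Dl + 6 s Dl <= 16 G + 26 s Dl. *)
have S1 : \sum_(k < K) Dl / 2 ^+ k.+2 * ell mu (B k.+1 t) <= G + Dl.
  rewrite -lee_fin; apply: (le_trans (sum_ell_le_integral _ _ _ (dxx t) Dl0)) => //.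
  apply: (@le_trans _ _ (\int[@lebesgue_measure R]_(r in `[0%R, Dl]%classic)
     (ell mu (pball d t r))%:E)%E).
    apply: ge0_subset_integral => //; first exact: measurable_ell_radius.
      by move=> x _; rewrite lee_fin ell_ge0.
    move=> x /=; rewrite !in_itv /= => /andP[x1 x2]; apply/andP; split.
      apply: ltW; apply: le_lt_trans x1.
      by rewrite ltW// divr_gt0// exprn_gt0.
    by apply: (le_trans x2); rewrite ler_pdivrMr// ler_peMr ?ler1n// ltW.
  have dD : diam d <= Dl by apply/diam_leP => //; exact: ltW.
  have /le_trans := integral_ell_le mu_prob t (ltW Dl0) dD; apply.
  by rewrite EFinD leeD2r.
have q0 : 0 <= (2 * (3 * s + 1) + 2 * K%:R + 2) / 2 ^+ K :> R.
  have K0 : 0 <= K%:R :> R by [].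
  by apply: divr_ge0; [have := s1; lra | rewrite exprn_ge0].
have sDl : Dl <= s * Dl by rewrite ler_peMl// ltW.
have : Dl * (2 * (3 * s + 1) + 2 -
    (2 * (3 * s + 1) + 2 * K%:R + 2) / 2 ^+ K) <= 6 * (s * Dl) + 4 * Dl.
  apply: (@le_trans _ _ (Dl * (2 * (3 * s + 1) + 2))); last by lra.
  by rewrite ler_pM2l// gerBl.
have := Dl0; lra.
Qed.

Lemma chaining (G : R) t u : (Gamma mu d <= G%:E)%E ->
  g t u <= D * (32 * G + 52 * (s * Dl)).
Proof.
move=> GG; have := chaining_avg t GG; have := chaining_avg u GG.
rewrite /ball_avg.
(* Since d <= Dl, the balls of level 0 are all of T. The chains from t and from u therefore end in
   averages over the same points, which doubles the constants. *)
have BT x : B 0 x = [set: T]%SET.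
  by apply/setP => y; rewrite !inE /r expr0 divr1 dDl.
have [_ mT _] := mu_prob; rewrite !BT mT => Hu Ht.
suff : g t u <= \sum_(v in [set: T]%SET) w v * g v t / 1 +
    \sum_(v in [set: T]%SET) w v * g v u / 1 by lra.
rewrite -big_split /=.
have -> : g t u = (\sum_(v in [set: T]%SET) w v) * g t u.
  by rewrite -(finite_probabilityE mu_prob) mT mul1r.
rewrite mulr_suml; apply: ler_sum => v _; rewrite !divr1 -mulrDr ler_wpM2l//.
by rewrite (gC v t) g_triangle.
Qed.

End Chaining.

(** * The pseudometrics of the partial sums *)

Section CoefDist.
Variables (R : realType) (Omega : Type) (X : normedModType R) (T : finType).
Implicit Type a : nat -> T -> Omega -> X.

Lemma coef_dist0 a w t u : coef_dist a 0 w t u = 0.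
Proof. by rewrite /coef_dist big_geq// sqrtr0. Qed.

Lemma coef_dist_ge0 a n w t u : 0 <= coef_dist a n w t u.
Proof. exact: sqrtr_ge0. Qed.

Lemma coef_dist_sqr a n w t u :
  coef_dist a n w t u ^+ 2 = \sum_(1 <= i < n.+1) `|a i t w - a i u w| ^+ 2.
Proof. by rewrite sqr_sqrtr// sumr_ge0// => i _; rewrite sqr_ge0. Qed.

Lemma coef_distS_sqr a n w t u : coef_dist a n.+1 w t u ^+ 2 =
  coef_dist a n w t u ^+ 2 + `|a n.+1 t w - a n.+1 u w| ^+ 2.
Proof. by rewrite !coef_dist_sqr big_nat_recr. Qed.

Lemma coef_distS a n w t u : coef_dist a n.+1 w t u =
  Num.sqrt (coef_dist a n w t u ^+ 2 + `|a n.+1 t w - a n.+1 u w| ^+ 2).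
Proof. by rewrite -coef_distS_sqr sqrtr_sqr ger0_norm ?coef_dist_ge0. Qed.

Lemma coef_distxx a n w t : coef_dist a n w t t = 0.
Proof.
by rewrite /coef_dist big1 ?sqrtr0// => i _; rewrite subrr normr0 expr0n.
Qed.

Lemma coef_distC a n w t u : coef_dist a n w t u = coef_dist a n w u t.
Proof.
by congr Num.sqrt; apply: eq_bigr => i _; rewrite distrC.
Qed.

(** Minkowski's inequality in the plane, from Cauchy-Schwarz; adding one coordinate at a time, it
    yields the triangle inequality for [coef_dist]. *)
Lemma minkowski2 (x y z v : R) : 0 <= x -> 0 <= y -> 0 <= z -> 0 <= v ->
  Num.sqrt ((x + y) ^+ 2 + (z + v) ^+ 2) <=
  Num.sqrt (x ^+ 2 + z ^+ 2) + Num.sqrt (y ^+ 2 + v ^+ 2).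
Proof.
move=> x0 y0 z0 v0; set p := Num.sqrt (x ^+ 2 + _); set q := Num.sqrt (y ^+ 2 + _).
have p0 : 0 <= p by exact: sqrtr_ge0.
have q0 : 0 <= q by exact: sqrtr_ge0.
have p2 : p ^+ 2 = x ^+ 2 + z ^+ 2 by rewrite sqr_sqrtr// addr_ge0 ?sqr_ge0.
have q2 : q ^+ 2 = y ^+ 2 + v ^+ 2 by rewrite sqr_sqrtr// addr_ge0 ?sqr_ge0.
clearbody p q.
rewrite -[leRHS](ger0_norm (addr_ge0 p0 q0)) -sqrtr_sqr ler_wsqrtr//.
suff : x * y + z * v <= p * q by nra.
rewrite -[leRHS](ger0_norm (mulr_ge0 p0 q0)) -sqrtr_sqr.
rewrite -[leLHS]ger0_norm ?addr_ge0 ?mulr_ge0// -sqrtr_sqr ler_wsqrtr//.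
rewrite exprMn p2 q2; have := sqr_ge0 (x * v - z * y); lra.
Qed.

Lemma coef_dist_triangle a n w t u v :
  coef_dist a n w t v <= coef_dist a n w t u + coef_dist a n w u v.
Proof.
elim: n => [|n IH]; first by rewrite !coef_dist0 addr0.
rewrite !coef_distS; apply: le_trans (minkowski2 _ _ _ _) => //;
  rewrite ?coef_dist_ge0//.
apply: ler_wsqrtr; apply: lerD; apply: lerXn2r;
  rewrite ?nnegrE ?addr_ge0 ?coef_dist_ge0//.
by rewrite -(subrKA (a n.+1 u w)) ler_normD.
Qed.

Lemma coef_dist_leS a n w t u : coef_dist a n w t u <= coef_dist a n.+1 w t u.
Proof.
rewrite coef_distS -[leLHS]ger0_norm ?coef_dist_ge0// -sqrtr_sqr.
by rewrite ler_wsqrtr// lerDl sqr_ge0.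
Qed.

Lemma coef_dist_mono a n m w t u : (n <= m)%N ->
  coef_dist a n w t u <= coef_dist a m w t u.
Proof.
move=> /subnK <-; elim: (m - n)%N => // k; rewrite addSn => /le_trans; apply.
exact: coef_dist_leS.
Qed.

Lemma le_coef_dist a n i w t u : (1 <= i <= n)%N ->
  `|a i t w - a i u w| <= coef_dist a n w t u.
Proof.
case: i => // i /= ni; apply: le_trans (coef_dist_mono _ _ _ _ ni).
rewrite coef_distS -[leLHS]ger0_norm// -sqrtr_sqr ler_wsqrtr//.
by rewrite lerDr sqr_ge0.
Qed.

End CoefDist.

(** * Measurability of the functionals of a random metric *)

Section GammaMeasurable.
Context dS (S : measurableType dS) (R : realType) (T : finType).
Variables (mu : {set T} -> R).
Hypothesis mu_prob : finite_probability mu.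
Hypothesis mu_pos : forall t : T, 0 < mu [set t]%SET.

Lemma measurable_bigmaxr (I : Type) (s : seq I) (f : I -> S -> R) (x : R) :
  (forall i, measurable_fun setT (f i)) ->
  measurable_fun setT (fun w => \big[Num.max/x]_(i <- s) f i w).
Proof.
move=> mf; elim: s => [|i s IH].
  by under eq_fun do rewrite big_nil; exact: measurable_cst.
under eq_fun do rewrite big_cons; exact: measurable_maxr.
Qed.

Lemma measurable_bigmaxe (I : Type) (s : seq I) (f : I -> S -> \bar R) x :
  (forall i, measurable_fun setT (f i)) ->
  measurable_fun setT (fun w => \big[maxe/x]_(i <- s) f i w).
Proof.
move=> mf; elim: s => [|i s IH].
  by under eq_fun do rewrite big_nil; exact: measurable_cst.
under eq_fun do rewrite big_cons; exact: measurable_maxe.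
Qed.

Variable ds : S -> T -> T -> R.
Hypothesis mds : forall t u, measurable_fun setT (fun s => ds s t u).

Lemma measurable_diam : measurable_fun setT (fun s => diam (ds s)).
Proof. by do 2 apply: measurable_bigmaxr => ?. Qed.

Lemma measurable_Gamma : measurable_fun setT (fun s => Gamma mu (ds s)).
Proof.
pose I t s := (\int[@lebesgue_measure R]_(r in `[0%R, diam (ds s)]%classic)
   (ell mu (pball (ds s) t r))%:E)%E.
rewrite (_ : (fun s => _) = fun s => \big[maxe/-oo%E]_(t : T) I t s); last first.
  apply/funext => s; apply/eqP; rewrite eq_le; apply/andP; split.
    by apply: ge_ereal_sup => _ [t _ <-]; apply: (le_bigmax_cond _ (fun t => I t s)).
  apply/bigmax_leP; split=> [|t _]; first exact: leNye.
  by apply: ereal_sup_ubound; exists t.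
apply: measurable_bigmaxe => t.
(* The random range of integration is moved into the integrand, so that Tonelli's theorem gives
   measurability in s. *)
pose f (x : S * measurableTypeR R) : \bar R :=
  (if (0 <= x.2) && (x.2 <= diam (ds x.1))
   then ell mu (pball (ds x.1) t x.2) else 0)%:E.
have mf : measurable_fun setT f.
  apply/measurable_EFinP; apply: measurable_fun_ifT => //.
    apply: measurable_and; apply: measurable_fun_ler => //.
    by apply: (measurableT_comp measurable_diam); exact: measurable_fst.
  apply: (@measurable_ell _ _ _ mu_prob) => // u.
  by apply: (measurableT_comp (mds t u)); exact: measurable_fst.
have f0 x : (0 <= f x)%E by rewrite lee_fin; case: ifP => // _; exact: ell_ge0.
rewrite (_ : I t = fun s => \int[@lebesgue_measure R]_r f (s, r))%E; last first.
  apply/funext => s; rewrite /I integral_mkcond; apply: eq_integral => r _.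
  rewrite patchE /f /=; case: ifPn.
    by rewrite inE /= in_itv /= => ->.
  by move=> /negP H; case: ifP => // h; case: H; rewrite inE /= in_itv.
exact: (measurable_fun_fubini_tonelli_F (m2 := @lebesgue_measure R) f mf f0).
Qed.

End GammaMeasurable.

(** * The good-lambda inequality *)

Section UnionBound.
Context d (Omega : measurableType d) (R : realType).
Variable P : {measure set Omega -> \bar R}.

Lemma measure_bigcup_geometric (E : nat -> set Omega) (c : R) : 0 <= c ->
  (forall k, measurable (E k)) ->
  (forall k, (P (E k) <= (c / 2 ^+ k.+1)%:E)%E) ->
  (P (\bigcup_k E k) <= c%:E)%E.
Proof.
move=> c0 mE PE.
have mU : measurable (\bigcup_k E k) by exact: bigcupT_measurable.
have /le_trans := measure_sigma_subadditive P mE mU (@subset_refl _ _); apply.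
have H := @cvg_geometric_eseries_half R c 0; rewrite expr0 divr1 in H.
rewrite -(cvg_lim _ H) //; apply: lee_nneseries => // k _.
by rewrite addn1 natrX.
Qed.

End UnionBound.

Section MaxOsc.
Context dO (Omega : measurableType dO) (R : realType).
Variables (T : finType) (X : normedModType R).
Variables (N : nat) (F : nat -> set (set Omega)).
Implicit Types (a : nat -> T -> Omega -> X) (e : nat -> Omega -> R).

Definition predictable_family a := forall t, predictable N F (fun i => a i t).

Definition max_osc e a n w : R :=
  \big[Num.max/0]_(0 <= j < n.+1) osc (sign_sum a e j w).

Lemma max_osc_leP e a n w c : 0 <= c ->
  reflect (forall j, (j <= n)%N -> osc (sign_sum a e j w) <= c)
    (max_osc e a n w <= c).
Proof.
move=> c0; rewrite /max_osc big_mkord; apply: (iffP idP).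
  by move=> /bigmax_leP[_ H] j jn; exact: (H (Ordinal (jn : (j < n.+1)%N)) isT).
by move=> H; apply/bigmax_leP; split=> // i _; apply: H; rewrite -ltnS.
Qed.

Lemma max_osc_gtP e a n w c : 0 <= c ->
  reflect (exists2 j, (j <= n)%N & c < osc (sign_sum a e j w))
    (c < max_osc e a n w).
Proof.
move=> c0; rewrite ltNge; apply: (iffP idP) => [/max_osc_leP H|[j jn H]].
  have := H c0; apply: contra_notP => /forall2NP H' j jn; rewrite leNgt.
  by case: (H' j) => // /negP.
by apply/negP => /max_osc_leP => /(_ c0 j jn); rewrite leNgt H.
Qed.

Lemma max_osc_ge0 e a n w : 0 <= max_osc e a n w.
Proof. by rewrite /max_osc big_mkord; exact: bigmax_ge_id. Qed.

Hypotheses (sepX : separable X) (filtF : filtration N F).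
Variable e : nat -> Omega -> R.
Hypothesis me : forall i, (1 <= i <= N)%N -> adapted_to (F i) (e i).

Lemma adaptedB G (f g : Omega -> X) :
  adapted_to G f -> adapted_to G g -> adapted_to G (fun w => f w - g w).
Proof.
move=> mf mg; rewrite (_ : (fun w => _) = fun w => f w + (-1) *: g w).
  by apply: adaptedD => //; apply: adaptedZ => //; exact: adapted_cst.
by apply/funext => w; rewrite scaleN1r.
Qed.

Lemma measurable_osc G (f : T -> Omega -> X) : (forall t, adapted_to G (f t)) ->
  measurable_fun setT
    ((fun w => osc (fun t => f t w)) : g_sigma_algebraType G -> R).
Proof.
move=> mf; do 2 apply: measurable_bigmaxr => ?.
by apply: adapted_norm; exact: adaptedB.
Qed.

Lemma measurable_max_osc a n : predictable_family a -> (n <= N)%N ->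
  measurable_fun setT (max_osc e a n : g_sigma_algebraType (F n) -> R).
Proof.
(* Replacing j by [minn j n] makes each term measurable at time n for every j, not only for those in
   the range. *)
move=> ha nN; rewrite (_ : max_osc e a n = fun w => \big[Num.max/0]_(0 <= j < n.+1)
    osc (sign_sum a e (minn j n) w)).
  apply: measurable_bigmaxr => j; apply: measurable_osc => t.
  apply: (adapted_sub (filtration_sub filtF (geq_minr j n) nN)).
  apply: (adapted_transform sepX filtF me (ha t)).
  exact: leq_trans (geq_minr j n) nN.
apply/funext => w; apply: eq_big_seq => j; rewrite mem_index_iota ltnS.
by move=> /minn_idPl ->.
Qed.

Lemma measurable_max_oscT a n : predictable_family a -> (n <= N)%N ->
  measurable_fun setT (max_osc e a n).
Proof.
move=> ha nN; apply: (sub_measurable_fun (filtration_sub_measurable filtF nN)).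
exact: measurable_max_osc.
Qed.

End MaxOsc.

Section GoodLambda.
Context dO (Omega : measurableType dO) (R : realType) (P : probability Omega R).
Variables (T : finType) (X : normedModType R) (D p : R) (mu : {set T} -> R).
Variables (N : nat) (F : nat -> set (set Omega)).
Variable e : nat -> Omega -> R.
Hypotheses (T0 : (0 < #|T|)%N) (sepX : separable X).
Hypotheses (D1 : 1 <= D) (smX : smooth2 X D) (p1 : 1 <= p).
Hypothesis mu_prob : finite_probability mu.
Hypothesis mu_pos : forall t : T, 0 < mu [set t]%SET.
Hypotheses (filtF : filtration N F) (he : predictable_signs P N F e).
Implicit Type a : nat -> T -> Omega -> X.

Definition control a n w : R :=
  fine (Gamma mu (coef_dist a n w)) + Num.sqrt p * diam (coef_dist a n w).

Let Gamma_fin (d : T -> T -> R) : Gamma mu d \is a fin_num.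
Proof. by rewrite ge0_fin_numE ?Gamma_ge0// Gamma_lty. Qed.

Let me := adapted_signs he.

Let sqrtp1 : 1 <= Num.sqrt p.
Proof. by rewrite -[leLHS]sqrtr1 ler_wsqrtr. Qed.

Lemma controlE a n w : (control a n w)%:E =
  (Gamma mu (coef_dist a n w) + (Num.sqrt p * diam (coef_dist a n w))%:E)%E.
Proof. by rewrite /control EFinD fineK ?Gamma_fin. Qed.

Lemma control_ge0 a n w : 0 <= control a n w.
Proof.
by rewrite addr_ge0 ?fine_ge0 ?Gamma_ge0// mulr_ge0 ?diam_ge0.
Qed.

Lemma control_mono a n m w : (n <= m)%N -> control a n w <= control a m w.
Proof.
move=> nm; apply: lerD.
  apply: fine_le; [exact: Gamma_fin|exact: Gamma_fin|].
  by apply: Gamma_mono => [||t|t|t u];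
    [| |exact: coef_distxx|exact: coef_distxx|exact: coef_dist_mono].
rewrite ler_wpM2l ?sqrtr_ge0//.
by apply: diam_mono => t u; exact: coef_dist_mono.
Qed.

Lemma control0 a w : control a 0 w = 0.
Proof.
have d0 : diam (coef_dist a 0 w) = 0.
  apply/eqP; rewrite eq_le diam_ge0 andbT; apply/diam_leP => // t u.
  by rewrite coef_dist0.
rewrite /control d0 mulr0 addr0.
suff -> : Gamma mu (coef_dist a 0 w) = 0%E by [].
apply/eqP; rewrite eq_le Gamma_ge0// andbT; apply: Gamma_leP => t.
by rewrite d0 set_itv1 integral_set1.
Qed.

(** The metric through step n involves only coefficients known at time n - 1. Hence [active] may
    test the control at the current step, although it sees the oscillation only up to the previous
    one. *)
Lemma measurable_control a n : predictable_family N F a -> (0 < n <= N)%N ->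
  measurable_fun setT (control a n : g_sigma_algebraType (F n.-1) -> R).
Proof.
case: n => // n ha /= nN.
have md t u : measurable_fun setT
   ((fun w => coef_dist a n.+1 w t u) : g_sigma_algebraType (F n) -> R).
  apply: (measurableT_comp (f := @Num.sqrt R)).
    by apply: continuous_measurable_fun; exact: sqrt_continuous.
  have hb : predictable N F (fun i w => a i t w - a i u w).
    by move=> i iN; apply: (adaptedB sepX); exact: ha.
  have H := measurable_square_sum filtF hb nN (leqnn n.+1) (ltnW nN).
  exact: H.
apply: measurable_funD.
  apply: (measurableT_comp (fine_measurable measurableT)).
  exact: measurable_Gamma.
apply: measurable_funM => //; exact: measurable_diam.
Qed.

Lemma measurable_controlT a n : predictable_family N F a -> (n <= N)%N ->
  measurable_fun setT (control a n).
Proof.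
case: n => [|n] ha nN.
  rewrite (_ : control a 0 = fun=> 0); first exact: measurable_cst.
  by apply/funext => w; rewrite control0.
apply: (sub_measurable_fun (filtration_sub_measurable filtF (ltnW nN))).
exact: (@measurable_control a n.+1 ha nN).
Qed.

Section Stopped.
Variables (a : nat -> T -> Omega -> X) (lam del : R).
Hypotheses (ha : predictable_family N F a) (lam0 : 0 < lam).
Hypotheses (del0 : 0 < del) (del1 : del <= 1).

(* The summands after the first time the oscillation exceeds lam, up to the
   first time it exceeds 4 lam, as long as the control is at most del lam. *)
Definition active i w : bool :=
  [&& lam < max_osc e a i.-1 w, max_osc e a i.-1 w <= 4 * lam &
      control a i w <= del * lam].

Definition stopped i t w : X := (active i w)%:R *: a i t w.

Let dl0 : 0 < del * lam. Proof. exact: mulr_gt0. Qed.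
Let lam40 : 0 <= 4 * lam. Proof. by rewrite mulr_ge0// ltW. Qed.

Lemma predictable_stopped : predictable_family N F stopped.
Proof.
move=> t [//|i] /= iN; apply: adaptedZ => //; last exact: (@ha t i.+1 iN).
apply/borel_funP.
have mY := measurable_max_osc sepX filtF me ha (ltnW iN : (i <= N)%N).
have mW := @measurable_control a i.+1 ha iN.
rewrite (_ : (fun w => _) = fun w => if active i.+1 w then 1 else 0); last first.
  by apply/funext => w; case: active.
apply: measurable_fun_ifT => //; apply: measurable_and.
  exact: measurable_fun_ltr.
by apply: measurable_and; exact: measurable_fun_ler.
Qed.

(** This feeds [exp_process_on] and is the source of the factor P(Y > lam). *)
Lemma stopped_eq0 i t w : (1 <= i <= N)%N -> max_osc e a N w <= lam ->
  stopped i t w = 0.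
Proof.
case: i => // i /= iN /max_osc_leP H; rewrite /stopped /active /=.
rewrite ltNge (_ : max_osc e a i w <= lam) ?scale0r//.
apply/max_osc_leP => [|j ji]; first exact: ltW.
by apply: H; [exact: ltW|exact: leq_trans ji (ltnW iN)].
Qed.

(** Take for i the last active index up to n, or 0 if there is none: later steps add nothing to the
    stopped metric. The bound thus holds on every path, even where the full control is large. *)
Lemma stopped_dominated n w : exists2 i, control a i w <= del * lam &
  forall t u, coef_dist stopped n w t u <= coef_dist a i w t u.
Proof.
have le_an k t u : coef_dist stopped k w t u <= coef_dist a k w t u.
  apply: ler_wsqrtr; apply: ler_sum => i _.
  rewrite lerXn2r ?nnegrE// -scalerBr normrZ.
  by case: active; rewrite ?normr1 ?mul1r// normr0 mul0r.
elim: n => [|n [i Wi Hi]].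
  by exists 0%N; [rewrite control0 ltW|move=> t u; rewrite !coef_dist0].
have [hn|hn] := boolP (active n.+1 w).
  by exists n.+1 => //; case/and3P: hn.
exists i => // t u; rewrite coef_distS /stopped (negbTE hn) !scale0r subr0.
by rewrite normr0 expr0n addr0 sqrtr_sqr ger0_norm ?coef_dist_ge0.
Qed.

(** The stopped sum is f_rho - f_tau, with tau and rho the first times at which the oscillation
    exceeds lam and 4 lam. It oscillates by more than 4 lam - 2 lam, as the overshoot at tau is at
    most one jump. *)
Lemma sign_sum_stopped w : 4 * lam < max_osc e a N w ->
  control a N w <= del * lam -> 2 * lam < osc (sign_sum stopped e N w).
Proof.
move=> YN WN.
have Hex c : c <= 4 * lam -> 0 <= c ->
    exists j, (j <= N)%N && (c < osc (sign_sum a e j w)).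
  move=> cl c0; have /(max_osc_gtP _ _ _ _ lam40)[j jN Hj] := YN.
  by exists j; rewrite jN (le_lt_trans cl Hj).
have l4 : lam <= 4 * lam by have := ltW lam0; lra.
have ext := Hex _ l4 (ltW lam0); have exr := Hex _ (lexx _) lam40.
case: (ex_minnP ext) => tau /andP[tauN Htau] min_tau.
case: (ex_minnP exr) => rho /andP[rhoN Hrho] min_rho.
have tau_rho : (tau <= rho)%N.
  by apply: min_tau; rewrite rhoN (le_lt_trans l4 Hrho).
(* The summand i + 1 takes the sum from time i to time i + 1, hence the range tau <= i < rho. *)
have active_E i : (i < N)%N -> active i.+1 w = (tau <= i < rho)%N.
  move=> iN; rewrite /active /= (_ : control a i.+1 w <= _) ?andbT; last first.
    exact: le_trans (control_mono _ _ iN) WN.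
  congr andb.
    apply/(max_osc_gtP _ _ _ _ (ltW lam0))/idP => [[j ji Hj]|ti].
      apply: (leq_trans _ ji); apply: min_tau.
      by rewrite Hj (leq_trans ji (ltnW iN)).
    by exists tau.
  apply/(max_osc_leP _ _ _ _ lam40)/idP => [H|ir j ji].
    rewrite ltnNge; apply/negP => ri; have := H _ ri.
    by rewrite leNgt Hrho.
  rewrite leNgt; apply/negP => Hj; have := min_rho j.
  rewrite Hj (leq_trans ji (ltnW iN)) => /(_ isT).
  by rewrite leqNgt (leq_ltn_trans ji ir).
have sumE n t : (n <= N)%N -> sign_sum stopped e n w t =
    sign_sum a e (minn n rho) w t - sign_sum a e (minn n tau) w t.
  elim: n => [|n IH] nN; first by rewrite !min0n subrr /sign_sum big_geq.
  have signS b k : sign_sum b e k.+1 w t = sign_sum b e k w t + e k.+1 w *: b k.+1 t w.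
    exact: (transformS e (fun i => b i t) k w).
  rewrite signS IH ?(ltnW nN)// /stopped active_E//.
  have [tn|nt] := leqP tau n; have [nr|rn] := ltnP n rho; rewrite /=.
  - by rewrite scale1r (minn_idPl nr) (minn_idPr (leqW tn)) signS addrAC.
  - by rewrite scale0r scaler0 addr0 (minn_idPr (leqW rn)) (minn_idPr (leqW tn)).
  - by rewrite scale0r scaler0 addr0 (minn_idPl nr) (minn_idPl nt) !subrr.
  - by have := leq_trans nt (leq_trans tau_rho rn); rewrite ltnn.
have fN : sign_sum stopped e N w =
    fun t => sign_sum a e rho w t - sign_sum a e tau w t.
  by apply/funext => t; rewrite sumE// (minn_idPr rhoN) (minn_idPr tauN).
(* Just before tau the oscillation is at most lam. One jump is at most the diameter, hence at most
   the control because sqrt p >= 1, hence at most del lam <= lam. *)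
have osc_tau : osc (sign_sum a e tau w) <= 2 * lam.
  case: tau tauN Htau min_tau {tau_rho active_E sumE fN} => [|tau] tauN Htau min_tau.
    apply/osc_leP => [|t u]; first by rewrite mulr_ge0// ltW.
    by rewrite /sign_sum !big_geq// subrr normr0 mulr_ge0// ltW.
  have -> : sign_sum a e tau.+1 w =
      fun t => sign_sum a e tau w t + e tau.+1 w *: a tau.+1 t w.
    by apply/funext => t; exact: (transformS e (fun i => a i t) tau w).
  apply: (le_trans (osc_triangle _ _)).
  have -> : 2 * lam = lam + lam by lra.
  apply: lerD.
    rewrite leNgt; apply/negP => H; have := min_tau tau.
    by rewrite H (ltnW tauN) ltnn => /(_ isT).
  apply/osc_leP => [|t u]; first exact: ltW.
  have [e1 _ _ _] := he (tauN : (1 <= tau.+1 <= N)%N).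
  rewrite -scalerBr normrZ (_ : `|e tau.+1 w| = 1); last first.
    by case: (e1 w) => ->; rewrite ?normrN normr1.
  rewrite mul1r (le_trans (le_coef_dist a w t u (tauN : (1 <= tau.+1 <= N)%N)))//.
  rewrite (le_trans (le_diam _ _ _))//.
  apply: (@le_trans _ _ (control a N w)).
    rewrite -[leLHS]add0r lerD ?fine_ge0 ?Gamma_ge0//.
    by rewrite ler_peMl ?diam_ge0.
  by rewrite (le_trans WN)// ler_piMl// ltW.
have : osc (sign_sum a e rho w) <=
    osc (sign_sum stopped e N w) + osc (sign_sum a e tau w).
  rewrite -[in leLHS](_ : (fun t => sign_sum stopped e N w t +
    sign_sum a e tau w t) = sign_sum a e rho w) ?osc_triangle//.
  by apply/funext => t; rewrite fN subrK.
lra.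
Qed.

(** The choice of [s] gives exp(- s^2) = exp(- 4 p), and a control of at most del lam forces a
    diameter of at most [Dl]. In the chaining bound s Dl = 2 del lam, so sqrt p cancels. *)
Let s : R := 2 * Num.sqrt p.
Let Dl : R := del * lam / Num.sqrt p.
Let l k n : R := n.+1%:R / (D * (Dl / 2 ^+ k)).

Definition pair_sum k n w : R :=
  \sum_u \sum_v mu [set u]%SET * mu [set v]%SET *
    pair_exp (coef_dist stopped N w)
      (fun t u => `|sign_sum stopped e N w t - sign_sum stopped e N w u|)
      D (l k n) u v.

Lemma osc_stopped_le w :
  (forall k n, pair_sum k n w <= expR (s ^+ 2) * 2 ^+ (k + n + 2)) ->
  osc (sign_sum stopped e N w) <= 136 * D * del * lam.
Proof.
move=> H; have [i Wi Hi] := stopped_dominated N w.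
have sp0 : 0 < Num.sqrt p := lt_le_trans ltr01 sqrtp1.
have Dl0 : 0 < Dl by rewrite divr_gt0.
have D0 : 0 < D := lt_le_trans ltr01 D1.
have diam_i : diam (coef_dist a i w) <= Dl.
  rewrite ler_pdivlMr// mulrC (le_trans _ Wi)//.
  by rewrite lerDr fine_ge0 ?Gamma_ge0.
have GG : (Gamma mu (coef_dist stopped N w) <= (del * lam)%:E)%E.
  apply: (@le_trans _ _ (Gamma mu (coef_dist a i w))).
    by apply: Gamma_mono => // t; exact: coef_distxx.
  rewrite -(fineK (Gamma_fin _)) lee_fin (le_trans _ Wi)//.
  by rewrite lerDl mulr_ge0 ?diam_ge0// ltW.
apply/osc_leP => [|t u].
  by rewrite !mulr_ge0// ltW.
have s1 : 1 <= s by have := sqrtp1; rewrite /s; lra.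
have := @chaining _ _ mu mu_prob mu_pos (coef_dist stopped N w)
  (fun t u => `|sign_sum stopped e N w t - sign_sum stopped e N w u|)
  D Dl s D0 Dl0 s1 (coef_distxx _ _ _) (coef_distC _ _ _)
  (coef_dist_triangle _ _ _) _ _ _ _ H (del * lam) t u GG.
(* 136 = 32 + 52 * 2, from G = del lam and s Dl = 2 del lam. *)
have -> : D * (32 * (del * lam) + 52 * (s * Dl)) = 136 * D * del * lam.
  by rewrite /s /Dl; field; rewrite gt_eqF.
apply.
- move=> x y; rewrite (le_trans (Hi x y))// (le_trans (le_diam _ x y))//.
- by move=> x y; rewrite distrC.
- by move=> x y z; rewrite -(subrKA (sign_sum stopped e N w y)) ler_normD.
(* At distance 0 all coefficients agree, so the signed sums coincide. *)
- move=> x y d0; apply/eqP; rewrite normr_eq0 subr_eq0; apply/eqP.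
  rewrite /sign_sum; apply: eq_big_nat => j jN; congr (_ *: _).
  apply/eqP; rewrite -subr_eq0 -normr_eq0 eq_le normr_ge0 andbT.
  exact: le_trans (le_coef_dist _ _ _ _ jN) d0.
Qed.

Lemma pair_sum_ge0 k n w : 0 <= pair_sum k n w.
Proof.
apply: sumr_ge0 => u _; apply: sumr_ge0 => v _.
by rewrite !mulr_ge0 ?expR_ge0 ?(ltW (cosh_gt0 _)) ?(ltW (mu_pos _)).
Qed.

Let diff u v i w : X := stopped i u w - stopped i v w.

Let predictable_diff u v : predictable N F (diff u v).
Proof. by move=> i iN; apply: (adaptedB sepX); exact: predictable_stopped. Qed.

Lemma pair_expE u v k n w :
  pair_exp (coef_dist stopped N w)
    (fun t u => `|sign_sum stopped e N w t - sign_sum stopped e N w u|)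
    D (l k n) u v = exp_process (l k n) D e (diff u v) N w.
Proof.
rewrite /pair_exp /exp_process coef_dist_sqr; congr (cosh (_ * `|_|) * _).
rewrite /sign_sum /transform -sumrB; apply: eq_bigr => i _.
by rewrite scalerBr.
Qed.

Let A : set Omega := [set w | lam < max_osc e a N w].

Let mA : measurable A.
Proof.
have := measurable_fun_ltr (measurable_cst lam)
  (measurable_max_oscT sepX filtF me ha (leqnn N)).
by move=> /(_ measurableT [set true]); rewrite setTI; exact.
Qed.

Let measurable_exp u v k n :
  measurable_fun setT (exp_process (l k n) D e (diff u v) N).
Proof.
apply: (sub_measurable_fun (filtration_sub_measurable filtF (leqnn N))).
exact: (measurable_exp_process sepX filtF (l k n) D he (predictable_diff u v)
  (leqnn N)).
Qed.

Lemma measurable_pair_sum k n : measurable_fun setT (pair_sum k n).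
Proof.
do 2 apply: measurable_sum => ?; apply: measurable_funM => //.
under eq_fun do rewrite pair_expE; exact: measurable_exp.
Qed.

(** A convex combination, with weights from mu x mu, of exponential processes that all stay at 1 off
    A. *)
Lemma integral_pair_sum k n :
  (\int[P]_(w in A) (pair_sum k n w)%:E <= P A)%E.
Proof.
have E0 u v w : (0 <= (mu [set u]%SET * mu [set v]%SET *
    exp_process (l k n) D e (diff u v) N w)%:E)%E.
  by rewrite lee_fin !mulr_ge0 ?(ltW (mu_pos _)) ?exp_process_ge0.
have mE u v : measurable_fun A (fun w => (mu [set u]%SET * mu [set v]%SET *
    exp_process (l k n) D e (diff u v) N w)%:E).
  by apply: measurable_funTS; apply/measurable_EFinP; exact: measurable_funM.
rewrite (eq_integral (fun w => \sum_u \sum_v (mu [set u]%SET * mu [set v]%SET *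
    exp_process (l k n) D e (diff u v) N w)%:E)%E); last first.
  move=> w _; rewrite /pair_sum -sumEFin; apply: eq_bigr => u _.
  by rewrite -sumEFin; apply: eq_bigr => v _; rewrite pair_expE.
rewrite ge0_integral_sum//; last 2 first.
- by move=> u; apply: emeasurable_sum => v; exact: mE.
- by move=> u w _; apply: sume_ge0.
apply: (@le_trans _ _ (\sum_u \sum_v
    (mu [set u]%SET * mu [set v]%SET)%:E * P A)%E).
  apply: lee_sum => u _; rewrite ge0_integral_sum//.
  apply: lee_sum => v _.
  under eq_integral do rewrite EFinM.
  rewrite ge0_integralZl //; last 3 first.
  - by apply: measurable_funTS; apply/measurable_EFinP; exact: measurable_exp.
  - by move=> w _; rewrite lee_fin exp_process_ge0.
  - by rewrite lee_fin mulr_ge0// ltW.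
  rewrite lee_wpmul2l ?lee_fin ?mulr_ge0 ?(ltW (mu_pos _))//.
  apply: (exp_process_on sepX filtF (l k n) D1 smX he (predictable_diff u v) mA).
  move=> i w iN; rewrite /A /= => /negP; rewrite -leNgt => Aw.
  by rewrite /diff !stopped_eq0// subrr.
have PAf : P A \is a fin_num by exact: fin_num_measure.
rewrite -(fineK PAf); under eq_bigr do under eq_bigr do rewrite -EFinM.
under eq_bigr do rewrite sumEFin.
rewrite sumEFin lee_fin; under eq_bigr do rewrite -mulr_suml -mulr_sumr.
rewrite -!mulr_suml; have [_ m1 _] := mu_prob.
have -> : \sum_u mu [set u]%SET = 1.
  rewrite -[RHS]m1 (finite_probabilityE mu_prob) [RHS]big_mkcond /=.
  by apply: eq_bigr => u _; rewrite inE.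
by rewrite !mul1r.
Qed.

Lemma good_lambda : del * (136 * D) <= 1 ->
  (P [set w | (4 * lam < max_osc e a N w)%R /\ (control a N w <= del * lam)%R] <=
   (expR (- (4 * p)))%:E * P [set w | (lam < max_osc e a N w)%R])%E.
Proof.
move=> delD.
pose E k n := A `&` [set w | expR (s ^+ 2) * 2 ^+ (k + n + 2) <= pair_sum k n w].
have mE k n : measurable (E k n).
  apply: measurableI => //.
  have := measurable_fun_ler (measurable_cst (expR (s ^+ 2) * 2 ^+ (k + n + 2)))
    (measurable_pair_sum k n).
  by move=> /(_ measurableT [set true]); rewrite setTI; exact.
have sub : [set w | 4 * lam < max_osc e a N w /\ control a N w <= del * lam] `<=`
    \bigcup_k \bigcup_n E k n.
  move=> w /= [YN WN]; apply: contrapT => nE.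
  have H k n : pair_sum k n w <= expR (s ^+ 2) * 2 ^+ (k + n + 2).
    rewrite leNgt; apply/negP => Hkn; apply: nE; exists k => //; exists n => //.
    split; last exact: ltW.
    by apply: le_lt_trans YN; have := ltW lam0; lra.
  (* On the good event the stopped sum oscillates by at most 136 D del lam <= lam, against more than
     2 lam. *)
  have := sign_sum_stopped YN WN; rewrite ltNge => /negP; apply.
  apply: (le_trans (osc_stopped_le H)).
  by have := ler_wpM2r (ltW lam0) delD; have := ltW lam0; lra.
have PAf : P A \is a fin_num by exact: fin_num_measure.
pose c : R := expR (- s ^+ 2) * fine (P A).
have c0 : 0 <= c by rewrite mulr_ge0 ?expR_ge0 ?fine_ge0.
(* Markov's inequality on A; the threshold splits as exp(s^2) 2^(k+1) 2^(n+1), giving two nested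
   geometric series of total 1. *)
have PE k n : (P (E k n) <= (c / 2 ^+ k.+1 / 2 ^+ n.+1)%:E)%E.
  have B0 : 0 < expR (s ^+ 2) * 2 ^+ (k + n + 2).
    by rewrite mulr_gt0 ?expR_gt0 ?exprn_gt0.
  have : ((expR (s ^+ 2) * 2 ^+ (k + n + 2))%:E * P (E k n) <= P A)%E.
    apply: le_trans (integral_pair_sum k n).
    rewrite -integral_cst//; apply: (@le_trans _ _
      (\int[P]_(w in E k n) (pair_sum k n w)%:E)%E).
      apply: ge0_le_integral => //.
      - by move=> w _; rewrite lee_fin ltW.
      - by apply: measurable_funTS; apply/measurable_EFinP; exact: measurable_pair_sum.
      - by move=> w [_ Hw]; rewrite lee_fin.
    apply: ge0_subset_integral => //.
    - by apply: measurable_funTS; apply/measurable_EFinP; exact: measurable_pair_sum.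
    - by move=> w _; rewrite lee_fin pair_sum_ge0.
    - by move=> w [].
  have PEf : P (E k n) \is a fin_num by exact: fin_num_measure.
  rewrite -(fineK PEf) -[in leRHS](fineK PAf) -EFinM !lee_fin.
  rewrite mulrC -ler_pdivlMr// => /le_trans; apply.
  rewrite /c expRN (_ : (k + n + 2)%N = (k.+1 + n.+1)%N); last first.
    by rewrite !addnS addn0 !addSn.
  by rewrite exprD !invfM; lra.
apply: (@le_trans _ _ (P (\bigcup_k \bigcup_n E k n))).
  apply: le_measure; rewrite ?inE//; last first.
    by apply: bigcupT_measurable => k; exact: bigcupT_measurable.
  rewrite [X in measurable X](_ : _ =
    [set w | 4 * lam < max_osc e a N w] `&` [set w | control a N w <= del * lam])//.
  apply: measurableI.
    have := measurable_fun_ltr (measurable_cst (4 * lam))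
      (measurable_max_oscT sepX filtF me ha (leqnn N)).
    by move=> /(_ measurableT [set true]); rewrite setTI; exact.
  have := measurable_fun_ler (measurable_controlT ha (leqnn N))
    (measurable_cst (del * lam)).
  by move=> /(_ measurableT [set true]); rewrite setTI; exact.
apply: (@le_trans _ _ c%:E).
  apply: measure_bigcup_geometric => // [k|k].
    exact: bigcupT_measurable.
  apply: measure_bigcup_geometric => //; last exact: PE.
  by rewrite divr_ge0// exprn_ge0.
rewrite -/A -[in leRHS](fineK PAf) -EFinM lee_fin /c.
rewrite ler_wpM2r ?fine_ge0// ler_expR lerN2 /s exprMn sqr_sqrtr.
  by lra.
exact: le_trans ler01 p1.
Qed.

End Stopped.

End GoodLambda.

(** * From tails to moments *)

Section GoodLambdaMoment.
Context dO (Omega : measurableType dO) (R : realType) (P : probability Omega R).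

Lemma lt_powR_root (p y r : R) : 0 < p -> 0 <= y -> 0 <= r ->
  (r < y `^ p) = (r `^ p^-1 < y).
Proof.
move=> p0 y0 r0; have rE : r = (r `^ p^-1) `^ p.
  by rewrite -powRrM mulVf ?gt_eqF// powRr1.
rewrite {1}rE; apply/idP/idP => [|H].
  apply: contraTT; rewrite -!leNgt => H.
  by apply: ge0_ler_powR => //; [exact: ltW|rewrite nnegrE powR_ge0].
by apply: gt0_ltr_powR => //; rewrite nnegrE powR_ge0.
Qed.

Lemma measurable_tail (u : Omega -> R) : measurable_fun setT u ->
  measurable_fun setT (fun r : R => P [set w | r < u w]).
Proof.
move=> meas_u.
pose U : {RV P >-> R} := HB.pack u (isMeasurableFun.Build _ _ _ _ u meas_u).
apply: (eq_measurable_fun (ccdf U)); last exact: ccdf_measurable.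
move=> r _; rewrite /ccdf /distribution /pushforward /=; congr (P _).
by apply/seteqP; split=> w /=; rewrite in_itv /= andbT.
Qed.

(** The layer-cake formula, over an open half-line because the tail inequality is available only at
    positive levels. *)
Lemma integral_tail (u : Omega -> R) : measurable_fun setT u ->
  (forall w, 0 <= u w) ->
  (\int[P]_w (u w)%:E =
   \int[@lebesgue_measure R]_(r in `]0%R, +oo[%classic) P [set w | (r < u w)%R])%E.
Proof.
move=> meas_u u0.
pose U : {RV P >-> R} := HB.pack u (isMeasurableFun.Build _ _ _ _ u meas_u).
rewrite integral_itv_obnd_cbnd; last first.
  by apply: measurable_funTS; exact: measurable_tail.
rewrite -[LHS](expectation_def U) ge0_expectation_ccdf//.
apply: eq_integral => r _.
rewrite /ccdf /distribution /pushforward /=; congr (P _).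
by apply/seteqP; split=> w /=; rewrite in_itv /= andbT.
Qed.

Lemma measurable_lt (u : Omega -> R) (r : R) : measurable_fun setT u ->
  measurable [set w | r < u w].
Proof.
move=> mf; have := measurable_fun_ltr (measurable_cst r) mf.
by move=> /(_ measurableT [set true]); rewrite setTI; exact.
Qed.

Variables (Y W : Omega -> R) (p b del eps : R).
Hypotheses (mY : measurable_fun setT Y) (mW : measurable_fun setT W).
Hypotheses (Y0 : forall w, 0 <= Y w) (W0 : forall w, 0 <= W w).
Hypotheses (p1 : 1 <= p) (b1 : 1 <= b) (del0 : 0 < del) (eps0 : 0 <= eps).
Hypothesis eps_b : eps * b `^ p <= 2^-1.
Hypothesis good : forall lam, 0 < lam ->
  (P [set w | (b * lam < Y w)%R /\ (W w <= del * lam)%R] <=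
   eps%:E * P [set w | (lam < Y w)%R])%E.

Let p0 : 0 < p. Proof. exact: lt_le_trans p1. Qed.
Let b0 : 0 < b. Proof. exact: lt_le_trans b1. Qed.

Let Z n w : R := Num.min (Y w) n%:R `^ p.

Let minY0 n w : 0 <= Num.min (Y w) n%:R.
Proof. by rewrite le_min Y0 ler0n. Qed.

Let mZ n : measurable_fun setT (Z n).
Proof.
by apply: (measurableT_comp (measurable_powR p)); exact: measurable_minr.
Qed.

Let V w : R := (del^-1 * W w) `^ p.

Let mV : measurable_fun setT V.
Proof.
by apply: (measurableT_comp (measurable_powR p)); exact: measurable_funM.
Qed.

(* Truncation makes the moment finite, so that it can be absorbed. *)
Let tail_truncated n (r : R) : 0 < r ->
  (P [set w | (r < (b^-1) `^ p * Z n w)%R] <=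
   P [set w | (r < V w)%R] + eps%:E * P [set w | (r < Z n w)%R])%E.
Proof.
(* Under r = lam^p the measure p lam^(p-1) d lam becomes Lebesgue measure in r. *)
move=> r0; pose lam := r `^ p^-1; have lam0 : 0 < lam by exact: powR_gt0.
have E1 : [set w | r < (b^-1) `^ p * Z n w] =
    [set w | b * lam < Num.min (Y w) n%:R].
  have H0 w : 0 <= b^-1 * Num.min (Y w) n%:R.
    by rewrite mulr_ge0// invr_ge0 ltW.
  apply/funext => w; apply/propext; rewrite /= -powRM ?invr_ge0 ?(ltW b0)//.
  by rewrite (lt_powR_root p0 (H0 w) (ltW r0)) ltr_pdivlMl.
have E2 : [set w | r < V w] = [set w | del * lam < W w].
  have H0 w : 0 <= del^-1 * W w by rewrite mulr_ge0// invr_ge0 ltW.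
  apply/funext => w; apply/propext; rewrite /= /V.
  by rewrite (lt_powR_root p0 (H0 w) (ltW r0)) ltr_pdivlMl.
have E3 : [set w | r < Z n w] = [set w | lam < Num.min (Y w) n%:R].
  by apply/seteqP; split=> w /=; rewrite /Z lt_powR_root ?(ltW r0).
rewrite E1 E2 E3.
have mT := @measurable_lt.
(* If n <= b lam, the event on the left is empty. Otherwise lam <= b lam < n, and the truncation is
   invisible at level lam. *)
have [bn|bn] := leP n%:R (b * lam).
  rewrite (_ : [set w | _] = set0) ?measure0 ?adde_ge0 ?mule_ge0 ?lee_fin//.
  by apply/seteqP; split => // w /=; rewrite lt_min => /andP[_]; rewrite ltNge bn.
have -> : [set w | lam < Num.min (Y w) n%:R] = [set w | lam < Y w].
  apply/seteqP; split=> w /=; rewrite lt_min; first by case/andP.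
  by move=> ->; rewrite (le_lt_trans _ bn)// ler_peMl// ltW.
have mG : measurable [set w | b * lam < Y w /\ W w <= del * lam].
  apply: measurableI; first exact: mT.
  rewrite [X in measurable X](_ : _ = ~` [set w | del * lam < W w]).
    by apply: measurableC; exact: mT.
  by apply/seteqP; split=> w /=; rewrite leNgt => /negP.
apply: (@le_trans _ _ (P ([set w | (b * lam < Y w)%R /\ (W w <= del * lam)%R] `|`
    [set w | (del * lam < W w)%R]))%E).
  apply: le_measure; rewrite ?inE//; first by apply: mT; exact: measurable_minr.
    by apply: measurableU => //; exact: mT.
  move=> w /=; rewrite lt_min => /andP[H _].
  by case: (leP (W w) (del * lam)) => HW; [left|right].
apply: (le_trans (measureU2 _ _ _)) => //; first exact: mT.
by rewrite addeC leeD2l// good.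
Qed.

Let moment_truncated n :
  (\int[P]_w (Z n w)%:E <= (2 * b `^ p)%:E * \int[P]_w (V w)%:E)%E.
Proof.
have Z0 w : 0 <= Z n w by exact: powR_ge0.
have c0 : 0 <= (b^-1) `^ p by exact: powR_ge0.
have bp0 : 0 < b `^ p by exact: powR_gt0.
have cb : (b^-1) `^ p * b `^ p = 1.
  by rewrite -powRM ?invr_ge0 ?(ltW b0)// mulVf ?gt_eqF// powR1.
have mEZ : measurable_fun setT (EFin \o Z n) by apply/measurable_EFinP.
have fin : (\int[P]_w (Z n w)%:E)%E \is a fin_num.
  rewrite ge0_fin_numE; last by apply: integral_ge0 => w _; rewrite lee_fin.
  apply: (@le_lt_trans _ _ (\int[P]_w (cst (n%:R `^ p)%:E w))%E).
    apply: ge0_le_integral => //.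
    - by move=> w _; rewrite lee_fin.
    - move=> w _; rewrite lee_fin; apply: ge0_ler_powR; rewrite ?nnegrE//.
        exact: ltW.
      by rewrite ge_min lexx orbT.
  by rewrite integral_cst//= probability_setT mule1 ltry.
have H : (((b^-1) `^ p)%:E * \int[P]_w (Z n w)%:E <=
    \int[P]_w (V w)%:E + eps%:E * \int[P]_w (Z n w)%:E)%E.
  rewrite -ge0_integralZl_EFin//; last by move=> w _; rewrite lee_fin.
  under eq_integral do rewrite -EFinM.
  have V0 w : 0 <= V w by exact: powR_ge0.
  have mbZ : measurable_fun setT (fun w => (b^-1) `^ p * Z n w).
    exact: measurable_funM.
  have bZ0 w : 0 <= (b^-1) `^ p * Z n w by rewrite mulr_ge0.
  rewrite (integral_tail mbZ bZ0) (integral_tail mV V0) (integral_tail (mZ n) Z0).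
  rewrite -ge0_integralZl_EFin//; last first.
    by apply: measurable_funTS; exact: measurable_tail.
  rewrite -ge0_integralD//; last 3 first.
  - by apply: measurable_funTS; exact: measurable_tail.
  - by move=> r _; rewrite mule_ge0// lee_fin.
  - by apply: measurable_funeM; apply: measurable_funTS; exact: measurable_tail.
  apply: ge0_le_integral => //.
  - by apply: measurable_funTS; apply: measurable_tail; exact: measurable_funM.
  - apply: emeasurable_funD.
      by apply: measurable_funTS; exact: measurable_tail.
    by apply: measurable_funeM; apply: measurable_funTS; exact: measurable_tail.
  - by move=> r /=; rewrite in_itv /= andbT => r0; exact: tail_truncated.
move: H fin; case: (\int[P]_w (Z n w)%:E)%E => [z| |]// H _.
have V0 : (0 <= \int[P]_w (V w)%:E)%E.
  by apply: integral_ge0 => w _; rewrite lee_fin powR_ge0.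
move: H V0; case: (\int[P]_w (V w)%:E)%E => [v| |]//; last first.
  by move=> _ _; rewrite gt0_muley ?leey// lte_fin mulr_gt0.
rewrite -!EFinM -EFinD !lee_fin => H v0.
have z0 : z <= 2 * b `^ p * v; last by [].
have [z_neg|z_pos] := leP z 0.
  by apply: (le_trans z_neg); rewrite !mulr_ge0// ltW.
(* Multiplying by b^p gives z <= b^p v + eps b^p z, and the last term is at most z / 2. *)
have := ler_wpM2r (ltW z_pos) eps_b; have := ler_wpM2l (ltW bp0) H.
rewrite mulrA (mulrC (b `^ p)) cb mul1r; lra.
Qed.

Lemma good_lambda_moment :
  (\int[P]_w (Y w `^ p)%:E <= (2 * b `^ p)%:E * \int[P]_w (V w)%:E)%E.
Proof.
have H : (\int[P]_w (Z n w)%:E)%E @[n --> \oo] --> (\int[P]_w (Y w `^ p)%:E)%E.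
  rewrite (_ : (\int[P]_w (Y w `^ p)%:E)%E =
      (\int[P]_w limn (fun n => (Z n w)%:E))%E).
    apply: cvg_monotone_convergence => //.
    - by move=> n; apply/measurable_EFinP.
    - by move=> n w _; rewrite lee_fin powR_ge0.
    - move=> w _ m n mn; rewrite lee_fin; apply: ge0_ler_powR; rewrite ?nnegrE//.
        exact: ltW.
      by rewrite le_min ge_min lexx /= ge_min ler_nat mn orbT.
  apply: eq_integral => w _; apply/esym/cvg_lim => //.
  apply: cvg_near_cst; near=> n; rewrite /Z min_l//.
  by apply: ltW; near: n; exact: nbhs_infty_gtr.
rewrite -(cvg_lim _ H)//; apply: lime_le; first exact: cvgP H.
by apply: nearW => n; exact: moment_truncated.
Unshelve. all: by end_near.
Qed.

End GoodLambdaMoment.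

(** * Modification of the signs on a null set *)

Section SymmetricSigns.
Context dO (Omega : measurableType dO) (R : realType) (P : probability Omega R).
Variables (N : nat) (F : nat -> set (set Omega)) (eps : nat -> Omega -> R).
Hypothesis filtF : filtration N F.
Hypothesis symm : forall i, (1 <= i <= N)%N ->
  [/\ symmetric_sign P (eps i), independent_of P (F i.-1) (eps i) &
      borel_measurable_wrt (F i) (eps i)].

(* The given signs take the values 1 and -1 only almost surely. *)
Definition exact_sign i w : R := if eps i w == 1 then 1 else -1.

Let measurable_eps i : (1 <= i <= N)%N -> measurable_fun setT (eps i).
Proof.
move=> iN; have [_ _ /adapted_wrt me] := symm iN; have /andP[_ iN'] := iN.
by apply/borel_funP; apply: adapted_borel me; exact: filtration_sub_measurable iN'.
Qed.

Let measurable_level i (x : R) : (1 <= i <= N)%N ->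
  measurable (eps i @^-1` [set x]).
Proof. by move=> iN; rewrite -[_ @^-1` _]setTI; exact: measurable_eps. Qed.

Lemma predictable_exact_sign : predictable_signs P N F exact_sign.
Proof.
move=> i iN; have [[P1 _] indep /adapted_wrt me] := symm iN.
have iN1 : (i.-1 <= N)%N by case/andP: iN => _; exact: leq_trans (leq_pred i).
have mone : (1 : R) <> -1 by lra.
have E1 : exact_sign i @^-1` [set 1] = eps i @^-1` [set 1].
  apply/seteqP; split=> w /=; rewrite /exact_sign; last by move=> ->; rewrite eqxx.
  by case: eqP => // _ H; case: mone.
have Em1 : exact_sign i @^-1` [set (-1)] = ~` (eps i @^-1` [set 1]).
  apply/seteqP; split=> w /=; rewrite /exact_sign; last by case: eqP.
  by case: eqP.
have half E : F i.-1 E -> P (E `&` eps i @^-1` [set 1]) = ((2^-1)%:E * P E)%E.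
  by move=> FE; rewrite indep// P1 muleC.
split.
- by move=> w; rewrite /exact_sign; case: eqP; [left|right].
- apply/borel_funP; apply: measurable_fun_ifT => //.
  by apply: measurable_fun_eqr => //; apply/borel_funP.
- by rewrite E1.
(* The modified sign is -1 exactly off the event that [eps i] is 1, so the second half weight
   follows by subtraction. *)
- move=> E FE; have mE : measurable E by exact: (filtration_sub_measurable filtF iN1).
  have H : P E = (P (E `\` eps i @^-1` [set 1%R]) + P (E `&` eps i @^-1` [set 1%R]))%E.
    exact: measureDI (measurable_level 1 iN).
  move: H; rewrite half// Em1 -setDE.
  have PEf : P E \is a fin_num by exact: fin_num_measure.
  have PDf : P (E `\` eps i @^-1` [set 1]) \is a fin_num.
    by apply: fin_num_measure; apply: measurableD => //; exact: measurable_level.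
  rewrite -(fineK PEf) -(fineK PDf) -!EFinM -EFinD => -[] H; congr EFin; lra.
Qed.

Lemma ae_exact_sign : {ae P, forall w, forall i, (1 <= i <= N)%N ->
  eps i w = exact_sign i w}.
Proof.
apply: ae_foralln => i; have [iN|niN] := boolP ((1 <= i <= N)%N); last first.
  by apply: aeW => w.
have [[P1 Pm1] _ _] := symm iN.
have m1 := measurable_level 1 iN; have mm1 := measurable_level (-1) iN.
have null : P (~` (eps i @^-1` [set 1] `|` eps i @^-1` [set (-1)])) = 0%E.
  rewrite probability_setC; last exact: measurableU.
  have -> : P (eps i @^-1` [set 1] `|` eps i @^-1` [set (-1)]) =
      (P (eps i @^-1` [set 1%R]) + P (eps i @^-1` [set (-1)%R]))%E.
    by apply: measureU => //; apply/seteqP; split => // w [/= -> ]; lra.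
  have halves : 2^-1 + 2^-1 = 1 :> R by lra.
  by rewrite P1 Pm1 -EFinD halves subrr.
exists (~` (eps i @^-1` [set 1] `|` eps i @^-1` [set (-1)])); split => //.
  by apply: measurableC; exact: measurableU.
move=> w /=; apply: contra_not => -[H _|H _]; rewrite /exact_sign H ?eqxx//.
  by case: eqP => //; lra.
Qed.

End SymmetricSigns.

(** * The moment inequality for exact signs *)

Section Moment.
Context dO (Omega : measurableType dO) (R : realType) (P : probability Omega R).
Variables (T : finType) (X : normedModType R) (D p : R) (mu : {set T} -> R).
Variables (N : nat) (F : nat -> set (set Omega)) (e : nat -> Omega -> R).
Variable a : nat -> T -> Omega -> X.
Hypotheses (T0 : (0 < #|T|)%N) (sepX : separable X).
Hypotheses (D1 : 1 <= D) (smX : smooth2 X D) (p1 : 1 <= p).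
Hypothesis mu_prob : finite_probability mu.
Hypothesis mu_pos : forall t : T, 0 < mu [set t]%SET.
Hypotheses (filtF : filtration N F) (he : predictable_signs P N F e).
Hypothesis ha : predictable_family N F a.

(** From 4 <= e^2 the product is at most exp(- 2 p), and exp(2 p) >= 1 + 2 p >= 2. *)
Let exp_pow4 : expR (- (4 * p)) * 4 `^ p <= 2^-1 :> R.
Proof.
have e2 : (4 : R) <= expR 2.
  have -> : (2 : R) = 1 + 1 by lra.
  rewrite expRD; have := expR_ge1Dx (1 : R) => H.
  by apply: (le_trans _ (ler_pM _ _ H H)); lra.
have p0 : 0 <= p by exact: le_trans p1.
have H : 4 `^ p <= expR (2 * p).
  by rewrite expRM; apply: ge0_ler_powR => //; rewrite nnegrE ?expR_ge0.
apply: (le_trans (ler_wpM2l (expR_ge0 _) H)); rewrite -expRD.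
have -> : - (4 * p) + 2 * p = - (2 * p) by lra.
rewrite expRN lef_pV2 ?posrE ?expR_gt0//.
by apply: le_trans (expR_ge1Dx _); have := p1; lra.
Qed.

Lemma max_osc_moment :
  (\int[P]_w (max_osc e a N w `^ p)%:E <=
   ((1088 * D) `^ p)%:E * \int[P]_w (control p mu a N w `^ p)%:E)%E.
Proof.
have D0 : 0 < D by exact: lt_le_trans D1.
have p0 : 0 <= p by exact: le_trans p1.
have K0 : 0 < 136 * D by rewrite mulr_gt0.
pose del := (136 * D)^-1.
have del0 : 0 < del by rewrite invr_gt0.
have del1 : del <= 1 by rewrite invf_le1//; have := D1; lra.
have delD : del * (136 * D) <= 1 by rewrite mulVf ?gt_eqF.
have mY := measurable_max_oscT sepX filtF (adapted_signs he) ha (leqnn N).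
have mW := measurable_controlT p T0 sepX mu_prob filtF ha (leqnn N).
have W0 w : 0 <= control p mu a N w by exact: control_ge0.
have b1 : (1 : R) <= 4 by lra.
have := good_lambda_moment mY mW (max_osc_ge0 e a N) W0 p1 b1 del0
  (expR_ge0 _) exp_pow4
  (fun lam lam0 => good_lambda T0 sepX D1 smX p1 mu_prob mu_pos filtF he ha lam0
     del0 del1 delD).
move=> /le_trans; apply.
have mWp : measurable_fun setT (EFin \o (fun w => control p mu a N w `^ p)).
  by apply/measurable_EFinP; exact: (measurableT_comp (measurable_powR p) mW).
have Wp0 w : [set: Omega] w -> (0 <= (control p mu a N w `^ p)%R%:E)%E.
  by move=> _; rewrite lee_fin powR_ge0.
under eq_integral do rewrite /del invrK powRM ?(ltW K0)// EFinM.
rewrite (ge0_integralZl_EFin P measurableT Wp0 mWp) ?powR_ge0// muleA -EFinM.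
apply: lee_wpmul2r; first exact: integral_ge0.
(* 1088 = 2 * 4 * 136: the factor 2 of the absorption is at most 2^p, 4^p comes from the levels, and
   136 D is 1 / del. *)
rewrite lee_fin (_ : 1088 * D = 2 * 4 * (136 * D)); last by lra.
rewrite (@powRM _ (2 * 4)) ?mulr_ge0 ?(ltW D0)// ler_wpM2r ?powR_ge0// powRM//.
by rewrite ler_wpM2r ?powR_ge0// -[leLHS]powRr1// ler_powR//; lra.
Qed.

End Moment.

Theorem mainTheorem12 (R : realType) :
  exists C : R, 0 < C /\
  forall (T : finType) (X : completeNormedModType R) (D : R)
    (mu : {set T} -> R)
    (dO : measure_display) (Omega : measurableType dO)
    (P : probability Omega R) (N : nat) (F : nat -> set (set Omega))
    (eps : nat -> Omega -> R) (a : nat -> T -> Omega -> X) (p : R),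
  (0 < #|T|)%N ->
  separable X ->
  1 <= D ->
  smooth2 X D ->
  finite_probability mu ->
  (forall t : T, 0 < mu [set t]%SET) ->
  filtration N F ->
  (forall i, (1 <= i <= N)%N ->
    [/\ symmetric_sign P (eps i),
        independent_of P (F i.-1) (eps i) &
        borel_measurable_wrt (F i) (eps i)]) ->
  (forall i t, (1 <= i <= N)%N -> borel_measurable_wrt (F i.-1) (a i t)) ->
  1 <= p ->
  ('N[P]_(p%:E)[(fun w =>
      (\big[Num.max/0]_(0 <= j < N.+1) osc (sign_sum a eps j w))%:E)]
   <= (C * D)%:E *
      'N[P]_(p%:E)[(fun w =>
        Gamma mu (coef_dist a N w)
        + (Num.sqrt p * diam (coef_dist a N w))%:E)])%E.
Proof.
exists 1088; split; first by rewrite ltr0n.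
move=> T X D mu dO Omega P N F eps a p T0 sepX D1 smX mu_prob
  mu_pos filtF symm ha p1.
have p0 : 0 < p by exact: lt_le_trans p1.
have CD0 : 0 <= 1088 * D by rewrite mulr_ge0 ?ler0n// (le_trans ler01 D1).
have pa : predictable_family N F a by move=> t i iN; apply: adapted_wrt; exact: ha.
have he := predictable_exact_sign filtF symm.
have meps i : (1 <= i <= N)%N -> adapted_to (F i) (eps i).
  by move=> iN; have [_ _ /adapted_wrt] := symm i iN.
pose Y := max_osc eps a N; pose Y' := max_osc (exact_sign eps) a N.
pose W := control p mu a N.
have Y0 w : 0 <= Y w by exact: max_osc_ge0.
have W0 w : 0 <= W w by exact: control_ge0.
have -> : (fun w => Gamma mu (coef_dist a N w) +
    (Num.sqrt p * diam (coef_dist a N w))%:E)%E = EFin \o W.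
  by apply/funext => w; rewrite /= /W controlE.
have normE (f : Omega -> R) : (forall w, 0 <= f w) ->
    'N[P]_(p%:E)[EFin \o f]%E = ((\int[P]_w (f w `^ p)%R%:E) `^ p^-1)%E.
  move=> f0; rewrite unlock; congr (_ `^ _)%E; apply: eq_integral => w _.
  by rewrite /= ger0_norm.
rewrite (normE W W0) (normE Y Y0).
have mYp e : (forall i, (1 <= i <= N)%N -> adapted_to (F i) (e i)) ->
    measurable_fun setT (fun w => (max_osc e a N w `^ p)%:E).
  move=> me; apply/measurable_EFinP; apply: (measurableT_comp (measurable_powR p)).
  exact: (measurable_max_oscT sepX filtF me pa (leqnn N)).
(* The given and the modified signs agree almost surely, so the moment may be computed with the
   latter. *)
have -> : (\int[P]_w (Y w `^ p)%:E = \int[P]_w (Y' w `^ p)%:E)%E.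
  apply: ge0_ae_eq_integral => //.
  - exact: mYp.
  - exact: mYp (adapted_signs he).
  - by move=> w _; rewrite lee_fin powR_ge0.
  - by move=> w _; rewrite lee_fin powR_ge0.
  apply: filterS (ae_exact_sign filtF symm) => w H _; congr (_ `^ p)%:E.
  apply: eq_big_nat => j jN; congr osc; apply/funext => t.
  apply: eq_big_nat => i /andP[i1 ij]; rewrite H// i1 -ltnS.
  exact: leq_trans ij jN.
have M := max_osc_moment T0 sepX D1 smX p1 mu_prob mu_pos filtF he pa.
move: (1088 * D) CD0 M => K K0 M.
have p_inv : 0 <= p^-1 by rewrite invr_ge0 ltW.
have IY : (0 <= \int[P]_w (Y' w `^ p)%:E)%E.
  by apply: integral_ge0 => w _; rewrite lee_fin powR_ge0.
have IW : (0 <= \int[P]_w (W w `^ p)%:E)%E.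
  by apply: integral_ge0 => w _; rewrite lee_fin powR_ge0.
(* Taking the p-th root is monotone on the extended half-line, which covers infinite moments. *)
apply: (le_trans (gt0_ler_poweR p_inv _ _ M)).
- by rewrite in_itv /= IY leey.
- by rewrite in_itv /= leey andbT mule_ge0// lee_fin powR_ge0.
rewrite poweRM ?lee_fin ?powR_ge0// poweR_EFin -powRrM mulfV ?gt_eqF//.
by rewrite powRr1.
Qed.
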